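(* For every positive equivalence relation $\eta$, there is an $\eta$-family which is behaviourally correctly learnable but not vacillatorily learnable.
   Context: A positive equivalence relation is an equivalence relation $\eta$ on $\mathbb{N}$ that is recursively enumerable (as a set of pairs) and has infinitely many equivalence classes. A set is $\eta$-closed if it is a union of $\eta$-equivalence classes. An $\eta$-family is an infinite family of $\eta$-closed sets possessing a uniformly r.e. one-one numbering $B_0,B_1,\dots$ (i.e. $\{\langle k,x\rangle:x\in B_k\}$ is r.e. and $B_i\neq B_j$ for $i\ne j$). $W_0,W_1,\dots$ is a fixed acceptable numbering of the r.e. sets. A text for $L$ is a total $T:\mathbb N\to\mathbb N\cup\{\#\}$ whose range minus $\{\#\}$ is $L$; $T[n]$ is its initial segment of length $n$. A learner is a recursive function $M$ from finite sequences over $\mathbb N\cup\{\#\}$ to $\mathbb N\cup\{?\}$; an output $e$ is interpreted as the hypothesis ''the $\eta$-closure of $W_e$''. A family $\mathcal C$ is behaviourally correctly learnable if some $M$, on every text $T$ for every $L\in\mathcal C$, outputs for almost all $n$ an index $M(T[n])$ whose hypothesis equals $L$; it is vacillatorily learnable if some $M$ behaviourally correctly learns $\mathcal C$ and, in addition, on every text $T$ for every $L\in\mathcal C$ the set $\{M(T[n]):n\ge 1\}$ is finite. *)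

(* Defs.v *)
From Stdlib Require Export Arith Cantor List Relations.
Import ListNotations.

Definition nset := nat -> Prop.
Definition same_set (A B : nset) : Prop := forall x, A x <-> B x.

Definition pair_code (x y : nat) : nat := Cantor.to_nat (x, y).

(** Unary programs over [nat] for the partial recursive functions, tuples being
    coded by the Cantor bijection.  With [<a,b>] for [pair_code a b]:
    [PRec f g] maps [<a,0>] to [f a] and [<a,n+1>] to [g <a,<n,r>>], where [r]
    is its value at [<a,n>]; [Mu f] maps [a] to the least [y] with
    [f <a,y> = 0], all [f <a,m>] for [m < y] being defined. *)
Inductive prog : Type :=
| Zero
| Succ
| Fst
| Snd
| Pair (f g : prog)
| Comp (f g : prog)
| PRec (f g : prog)
| Mu (f : prog).

Fixpoint prec_graph (F G : nat -> nat -> Prop) (a n y : nat) : Prop :=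
  match n with
  | 0 => F a y
  | S m => exists r, prec_graph F G a m r /\ G (pair_code a (pair_code m r)) y
  end.

(** [computes p a y]: program [p] halts on input [a] with output [y]. *)
Fixpoint computes (p : prog) (a y : nat) : Prop :=
  match p with
  | Zero => y = 0
  | Succ => y = S a
  | Fst => y = fst (Cantor.of_nat a)
  | Snd => y = snd (Cantor.of_nat a)
  | Pair f g => exists u v, computes f a u /\ computes g a v /\ y = pair_code u v
  | Comp f g => exists u, computes g a u /\ computes f u y
  | PRec f g =>
      prec_graph (computes f) (computes g)
        (fst (Cantor.of_nat a)) (snd (Cantor.of_nat a)) y
  | Mu f =>
      computes f (pair_code a y) 0 /\
      forall m, m < y -> exists k, computes f (pair_code a m) (S k)
  end.

Lemma computes_functional (p : prog) :
  forall a y z, computes p a y -> computes p a z -> y = z.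
Proof.
induction p as [ | | | | f IHf g IHg | f IHf g IHg | f IHf g IHg | f IHf];
  simpl; intros a y z Hy Hz; try congruence.
- destruct Hy as (u & v & Hu & Hv & ->), Hz as (u' & v' & Hu' & Hv' & ->).
  now rewrite (IHf _ _ _ Hu Hu'), (IHg _ _ _ Hv Hv').
- destruct Hy as (u & Hu & Hy), Hz as (u' & Hu' & Hz).
  rewrite (IHg _ _ _ Hu Hu') in Hy. exact (IHf _ _ _ Hy Hz).
- revert y z Hy Hz.
  generalize (fst (Cantor.of_nat a)) as b, (snd (Cantor.of_nat a)) as n.
  intros b n; induction n as [ | n IH]; simpl; intros y z Hy Hz.
  + exact (IHf _ _ _ Hy Hz).
  + destruct Hy as (r & Hr & Hy), Hz as (r' & Hr' & Hz).
    rewrite (IH _ _ Hr Hr') in Hy. exact (IHg _ _ _ Hy Hz).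
- destruct Hy as (Hy & Ly), Hz as (Hz & Lz).
  destruct (Nat.lt_trichotomy y z) as [H | [H | H]]; [ | exact H | ].
  + destruct (Lz _ H) as (k & Hk). discriminate (IHf _ _ _ Hy Hk).
  + destruct (Ly _ H) as (k & Hk). discriminate (IHf _ _ _ Hz Hk).
Qed.

Definition recursive (f : nat -> nat) : Prop :=
  exists p, forall a, computes p a (f a).

Definition re (A : nset) : Prop :=
  exists p, forall x, A x <-> exists y, computes p x y.

(** R.e. as a set of pairs; for a numbering [k |-> R k], uniformly r.e. *)
Definition re2 (R : nat -> nat -> Prop) : Prop :=
  re (fun z => R (fst (Cantor.of_nat z)) (snd (Cantor.of_nat z))).

(** Acceptability of a numbering of the r.e. sets: [W] is uniformly r.e. and
    every uniformly r.e. numbering translates recursively into [W].  (A single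
    r.e. set is the constant case, so [W] numbers exactly the r.e. sets.) *)
Definition acceptable (W : nat -> nset) : Prop :=
  re2 W /\
  forall V : nat -> nset, re2 V ->
    exists f, recursive f /\ forall e, same_set (V e) (W (f e)).

(** Infinitely many classes: no finite list of elements represents them all. *)
Definition positive_equivalence (eta : nat -> nat -> Prop) : Prop :=
  equivalence nat eta /\ re2 eta /\
  ~ exists l : list nat, forall x, exists y, In y l /\ eta y x.

(** The union of the [eta]-classes of the elements of [A]. *)
Definition eta_closure (eta : nat -> nat -> Prop) (A : nset) : nset :=
  fun x => exists y, A y /\ eta y x.

(** A union of classes is the union of the classes of some set of
    representatives. *)
Definition eta_closed (eta : nat -> nat -> Prop) (A : nset) : Prop :=
  exists S : nset, same_set A (eta_closure eta S).

(** Membership in [C] is up to extensional equality of sets; infinitude of [C]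
    is the injectivity of [B]. *)
Definition eta_family (eta : nat -> nat -> Prop) (C : nset -> Prop) : Prop :=
  exists B : nat -> nset,
    re2 B /\
    (forall i j, i <> j -> ~ same_set (B i) (B j)) /\
    (forall k, eta_closed eta (B k)) /\
    (forall L, C L <-> exists k, same_set L (B k)).

(** [None] is the pause symbol # in texts and ? as a learner's output. *)
Definition is_text (T : nat -> option nat) (L : nset) : Prop :=
  forall x, L x <-> exists n, T n = Some x.

Definition initial (T : nat -> option nat) (n : nat) : list (option nat) :=
  map T (seq 0 n).

Definition option_code (o : option nat) : nat :=
  match o with None => 0 | Some x => S x end.

(** A bijection from the finite sequences onto [nat]. *)
Fixpoint seq_code (s : list (option nat)) : nat :=
  match s with
  | [] => 0
  | o :: s' => S (pair_code (option_code o) (seq_code s'))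
  end.

Definition learner := list (option nat) -> option nat.

Definition recursive_learner (M : learner) : Prop :=
  exists p, forall s, computes p (seq_code s) (option_code (M s)).

Definition bc_learns (W : nat -> nset) (eta : nat -> nat -> Prop)
    (M : learner) (C : nset -> Prop) : Prop :=
  forall L, C L -> forall T, is_text T L ->
    exists n0, forall n, n0 <= n ->
      exists e, M (initial T n) = Some e /\ same_set (eta_closure eta (W e)) L.

Definition bc_learnable (W : nat -> nset) (eta : nat -> nat -> Prop)
    (C : nset -> Prop) : Prop :=
  exists M, recursive_learner M /\ bc_learns W eta M C.

Definition vac_learnable (W : nat -> nset) (eta : nat -> nat -> Prop)
    (C : nset -> Prop) : Prop :=
  exists M, recursive_learner M /\ bc_learns W eta M C /\
    forall L, C L -> forall T, is_text T L ->
      exists l : list (option nat), forall n, 1 <= n -> In (M (initial T n)) l.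

(* Main.v *)
Require Import Defs.
From Stdlib Require Import Lia Classical ClassicalEpsilon.
Import ListNotations.

(** Call [s, N] locking for a learner on [L] if [s] is over [L] and the learner's
    outputs on the extensions of [s] over [L] are bounded by [N].  A vacillatory
    learner has such a pair on every set it learns, and all sets of the family
    between the content of [s] and [L] then share finitely many hypotheses.

    Families of finite unions of classes are behaviourally correctly learnable: the
    closure of the data is the hypothesis.  So if the unions of at most two classes
    (made into a one-one numbered family) are not vacillatorily learnable, nothing
    remains to be shown.  If a learner does learn them, then a locking pair for the
    class of [b] can be found in the limit, and the elements [y] for which some
    extension over the classes of [b] and [y] has an output above [N] form an r.e.
    union of all classes but that of [b] and finitely many others.  This gives, for
    every [m], an r.e. set [U] that contains the first [m] classes, omits the next
    one and has infinitely many classes, with an index computable in the limit from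
    [m].  Since the first omitted class identifies [m] in the limit, one can
    diagonalize separately for each [m] inside [U]: the family gets [U] itself if no
    pair is locking on [U] for the learner attached to [m], and otherwise a finite
    part of [U] together with the traces on [U] of all large initial segments.
    Hypotheses enumerate the closure of the data, and the limit set of the column
    as soon as it contains the data. *)

Notation pi1 z := (fst (Cantor.of_nat z)).
Notation pi2 z := (snd (Cantor.of_nat z)).

(** * Recursive functions and decidable predicates *)

Lemma pi1_pair a b : pi1 (pair_code a b) = a.
Proof. unfold pair_code; now rewrite Cantor.cancel_of_to. Qed.

Lemma pi2_pair a b : pi2 (pair_code a b) = b.
Proof. unfold pair_code; now rewrite Cantor.cancel_of_to. Qed.

Lemma pair_pi z : pair_code (pi1 z) (pi2 z) = z.
Proof. unfold pair_code; rewrite <- surjective_pairing; apply Cantor.cancel_to_of. Qed.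

Lemma pair_code_inj a b c d : pair_code a b = pair_code c d -> a = c /\ b = d.
Proof.
intros H; split.
- now rewrite <- (pi1_pair a b), H, pi1_pair.
- now rewrite <- (pi2_pair a b), H, pi2_pair.
Qed.

Lemma pair_code_ge a b : a <= pair_code a b /\ b <= pair_code a b.
Proof.
unfold pair_code; pose proof (Cantor.to_nat_non_decreasing a b); lia.
Qed.

(* From here on pairs are handled only through the equations and bounds above, so that [simpl] never
   unfolds the Cantor bijection. *)
Global Opaque Cantor.of_nat Cantor.to_nat pair_code.

Ltac simp_pi := repeat (rewrite pi1_pair in * || rewrite pi2_pair in *).

Lemma rec_id : recursive (fun x => x).
Proof.
exists (Pair Fst Snd); intros a; exists (pi1 a), (pi2 a); simpl.
now rewrite pair_pi.
Qed.

Lemma rec_const n : recursive (fun _ => n).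
Proof.
induction n as [ | n [p Hp]].
- now exists Zero.
- exists (Comp Succ p); intros a; exists n; split; [apply Hp | reflexivity].
Qed.

Lemma rec_comp f g : recursive f -> recursive g -> recursive (fun x => f (g x)).
Proof.
intros [p Hp] [q Hq]; exists (Comp p q); intros a; exists (g a); auto.
Qed.

Lemma rec_pi1 f : recursive f -> recursive (fun x => pi1 (f x)).
Proof. apply (rec_comp (fun x => pi1 x)); now exists Fst. Qed.

Lemma rec_pi2 f : recursive f -> recursive (fun x => pi2 (f x)).
Proof. apply (rec_comp (fun x => pi2 x)); now exists Snd. Qed.

Lemma rec_succ f : recursive f -> recursive (fun x => S (f x)).
Proof. apply (rec_comp S); now exists Succ. Qed.

Lemma rec_pair f g :
  recursive f -> recursive g -> recursive (fun x => pair_code (f x) (g x)).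
Proof.
intros [p Hp] [q Hq]; exists (Pair p q); intros a; exists (f a), (g a); auto.
Qed.

Definition recursive2 (f : nat -> nat -> nat) : Prop :=
  recursive (fun z => f (pi1 z) (pi2 z)).

Lemma rec_comp2 F f g :
  recursive2 F -> recursive f -> recursive g -> recursive (fun x => F (f x) (g x)).
Proof.
intros HF Hf Hg.
destruct (rec_comp _ _ HF (rec_pair _ _ Hf Hg)) as [p Hp].
exists p; intros a; specialize (Hp a); cbv beta in Hp; simp_pi; exact Hp.
Qed.

Lemma rec_ext f g : (forall x, f x = g x) -> recursive f -> recursive g.
Proof. intros E [p Hp]; exists p; intros a; rewrite <- E; apply Hp. Qed.

Lemma rec_nat_rect (f : nat -> nat) (g : nat -> nat -> nat -> nat) :
  recursive f ->
  recursive (fun z => g (pi1 z) (pi1 (pi2 z)) (pi2 (pi2 z))) ->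
  recursive2 (fun a n => nat_rect (fun _ => nat) (f a) (g a) n).
Proof.
intros [p Hp] [q Hq]; exists (PRec p q); intros z; simpl.
generalize (pi1 z) as a, (pi2 z) as n; clear z; intros a n.
induction n as [ | n IH]; simpl; [apply Hp | ].
eexists; split; [exact IH | ].
specialize (Hq (pair_code a (pair_code n (nat_rect (fun _ => nat) (f a) (g a) n)))).
simp_pi; exact Hq.
Qed.

(** Directed by the syntax of the body. A body free of the variable is a constant whatever its
    shape, hence the first case; hypotheses are tried before [recdb]. *)
Ltac rec :=
  lazymatch goal with
  | |- recursive (fun _ => ?c) => apply rec_const
  | |- recursive (fun x => x) => apply rec_id
  | |- recursive (fun x => fst (Cantor.of_nat (@?f x))) => apply (rec_pi1 f); rec
  | |- recursive (fun x => snd (Cantor.of_nat (@?f x))) => apply (rec_pi2 f); rec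
  | |- recursive (fun x => S (@?f x)) => apply (rec_succ f); rec
  | |- recursive (fun x => pair_code (@?f x) (@?g x)) => apply (rec_pair f g); rec
  | H : recursive2 ?F |- recursive (fun x => ?F (@?f x) (@?g x)) =>
      apply (rec_comp2 F f g H); rec
  | H : recursive ?F |- recursive (fun x => ?F (@?f x)) =>
      apply (rec_comp F f H); rec
  | |- recursive (fun x => ?F (@?f x) (@?g x)) =>
      apply (rec_comp2 F f g); [solve [auto with recdb] | rec | rec]
  | |- recursive (fun x => ?F (@?f x)) =>
      apply (rec_comp F f); [solve [auto with recdb] | rec]
  | |- recursive _ => solve [auto with recdb]
  end.

Create HintDb recdb.

Lemma rec_add : recursive2 Nat.add.
Proof.
refine (rec_ext _ _ _ (rec_nat_rect (fun a => a) (fun _ _ r => S r) _ _)); try rec.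
intros z; cbv beta; generalize (pi1 z), (pi2 z); intros a n.
induction n; simpl; lia.
Qed.

Lemma rec_pred : recursive Nat.pred.
Proof.
pose proof (rec_nat_rect (fun _ => 0) (fun _ n _ => n)) as H.
refine (rec_ext _ _ _ (rec_comp2 _ (fun _ => 0) (fun x => x) (H _ _) _ _)); try rec.
now intros [ | n].
Qed.
#[global] Hint Resolve rec_add rec_pred : recdb.

Lemma rec_sub : recursive2 Nat.sub.
Proof.
refine (rec_ext _ _ _ (rec_nat_rect (fun a => a) (fun _ _ r => Nat.pred r) _ _)); try rec.
intros z; cbv beta; generalize (pi1 z), (pi2 z); intros a n.
induction n; simpl; lia.
Qed.

(** Every number is read as an infinite sequence of nested pairs, so that no length has to be
    stored. *)
Definition tail (s n : nat) : nat := Nat.iter n (fun l => pi2 l) s.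

Lemma rec_tail : recursive2 tail.
Proof.
refine (rec_ext _ _ _ (rec_nat_rect (fun a => a) (fun _ _ r => pi2 r) _ _)); try rec.
reflexivity.
Qed.
#[global] Hint Resolve rec_sub rec_tail : recdb.

Definition item (l n : nat) : nat := pi1 (tail l n).

Lemma rec_item : recursive2 item.
Proof. unfold recursive2, item; rec. Qed.
#[global] Hint Resolve rec_item : recdb.

(** Finite choice coded in one number: this moves an existential quantifier in front of a bounded
    universal one. *)
Lemma item_choice (P : nat -> nat -> Prop) n :
  (forall j, j < n -> exists y, P j y) -> exists l, forall j, j < n -> P j (item l j).
Proof.
revert P; induction n as [ | n IH]; intros P H.
- exists 0; lia.
- destruct (H 0) as [y0 Hy0]; [lia | ].
  destruct (IH (fun j => P (S j))) as [l Hl]; [intros; apply H; lia | ].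
  exists (pair_code y0 l); intros [ | j] Hj; unfold item, tail.
  + simpl; now simp_pi.
  + rewrite Nat.iter_succ_r; simp_pi; apply Hl; lia.
Qed.

(** Zero stands for truth: this is what [Mu] searches for, and it makes conjunction a sum and [<=] a
    truncated difference. *)
Definition dec (P : nat -> Prop) : Prop :=
  exists f, recursive f /\ forall x, P x <-> f x = 0.

Definition dec2 (P : nat -> nat -> Prop) : Prop :=
  dec (fun z => P (pi1 z) (pi2 z)).

Definition dec3 (P : nat -> nat -> nat -> Prop) : Prop :=
  dec (fun z => P (pi1 z) (pi1 (pi2 z)) (pi2 (pi2 z))).

Lemma dec_ext P Q : (forall x, P x <-> Q x) -> dec P -> dec Q.
Proof.
intros E (f & Hf & HP); exists f; split; [exact Hf | intros x].
rewrite <- E; apply HP.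
Qed.

Lemma dec_comp P f : dec P -> recursive f -> dec (fun x => P (f x)).
Proof.
intros (g & Hg & HP) Hf; exists (fun x => g (f x)); split; [rec | ].
intros x; apply HP.
Qed.

Lemma dec2_comp P f g :
  dec2 P -> recursive f -> recursive g -> dec (fun x => P (f x) (g x)).
Proof.
intros HP Hf Hg.
refine (dec_ext _ _ _ (dec_comp _ (fun x => pair_code (f x) (g x)) HP _)); [ | rec].
intros x; cbv beta; now simp_pi.
Qed.

Lemma dec3_comp P f g h :
  dec3 P -> recursive f -> recursive g -> recursive h ->
  dec (fun x => P (f x) (g x) (h x)).
Proof.
intros HP Hf Hg Hh.
refine (dec_ext _ _ _
  (dec_comp _ (fun x => pair_code (f x) (pair_code (g x) (h x))) HP _)); [ | rec].
intros x; cbv beta; now simp_pi.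
Qed.

Lemma dec_le f g : recursive f -> recursive g -> dec (fun x => f x <= g x).
Proof. intros; exists (fun x => f x - g x); split; [rec | intros; lia]. Qed.

Lemma dec_lt f g : recursive f -> recursive g -> dec (fun x => f x < g x).
Proof. intros; apply (dec_le (fun x => S (f x))); [rec | assumption]. Qed.

Lemma dec_eq f g : recursive f -> recursive g -> dec (fun x => f x = g x).
Proof.
intros; exists (fun x => (f x - g x) + (g x - f x)); split; [rec | intros; lia].
Qed.

Lemma dec_and P Q : dec P -> dec Q -> dec (fun x => P x /\ Q x).
Proof.
intros (f & Hf & HP) (g & Hg & HQ).
exists (fun x => f x + g x); split; [rec | ].
intros x; rewrite HP, HQ; lia.
Qed.

Lemma dec_not P : dec P -> dec (fun x => ~ P x).
Proof.
intros (f & Hf & HP); exists (fun x => 1 - f x); split; [rec | ].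
intros x; rewrite HP; lia.
Qed.

Lemma dec_or P Q : dec P -> dec Q -> dec (fun x => P x \/ Q x).
Proof.
intros HP HQ.
apply dec_ext with (fun x => ~ (~ P x /\ ~ Q x)).
- intros x; tauto.
- now apply dec_not, dec_and; apply dec_not.
Qed.

Lemma dec_imp P Q : dec P -> dec Q -> dec (fun x => P x -> Q x).
Proof.
intros HP HQ.
apply dec_ext with (fun x => ~ P x \/ Q x).
- intros x; tauto.
- apply dec_or; [now apply dec_not | exact HQ].
Qed.

(** The sum of the values below the bound vanishes exactly if all of them do. *)
Lemma dec_all_lt P b :
  dec2 P -> recursive b -> dec (fun x => forall y, y < b x -> P x y).
Proof.
intros (f & Hf & HP) Hb.
pose proof (rec_nat_rect (fun _ => 0) (fun x n r => r + f (pair_code x n))) as HR.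
exists (fun x => nat_rect (fun _ => nat) 0 (fun n r => r + f (pair_code x n)) (b x)).
split.
- refine (rec_comp2 _ (fun x => x) b (HR _ _) _ Hb); rec.
- intros x; generalize (b x); intros n; induction n as [ | n IH]; simpl.
  + split; [reflexivity | lia].
  + assert (E : P x n <-> f (pair_code x n) = 0).
    { specialize (HP (pair_code x n)); simp_pi; exact HP. }
    split.
    * intros H.
      assert (P x n) by (apply H; lia).
      assert (forall y, y < n -> P x y) by (intros; apply H; lia).
      rewrite E in *; rewrite IH in *; lia.
    * intros H y Hy.
      destruct (Nat.eq_dec y n) as [-> | Hn]; [apply E; lia | ].
      apply IH; lia.
Qed.

Lemma dec_ex_lt P b :
  dec2 P -> recursive b -> dec (fun x => exists y, y < b x /\ P x y).
Proof.
intros HP Hb.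
apply dec_ext with (fun x => ~ forall y, y < b x -> ~ P x y).
- intros x; split.
  + intros H; apply NNPP; firstorder.
  + firstorder.
- apply dec_not, dec_all_lt; [now apply dec_not | exact Hb].
Qed.

Ltac decide_pred :=
  lazymatch goal with
  | |- dec2 _ => unfold dec2; decide_pred
  | |- dec3 _ => unfold dec3; decide_pred
  | |- dec (fun x => @?P x /\ @?Q x) => apply (dec_and P Q); decide_pred
  | |- dec (fun x => @?P x \/ @?Q x) => apply (dec_or P Q); decide_pred
  | |- dec (fun x => ~ @?P x) => apply (dec_not P); decide_pred
  | |- dec (fun x => @?f x <= @?g x) => apply (dec_le f g); rec
  | |- dec (fun x => @?f x < @?g x) => apply (dec_lt f g); rec
  | |- dec (fun x => @?f x = @?g x) => apply (dec_eq f g); rec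
  | |- dec (fun x => forall y, y < @?b x -> @?P x y) =>
      apply (dec_all_lt P b); [decide_pred | rec]
  | |- dec (fun x => exists y, y < @?b x /\ @?P x y) =>
      apply (dec_ex_lt P b); [decide_pred | rec]
  | |- dec (fun x => @?P x -> @?Q x) => apply (dec_imp P Q); decide_pred
  | H : dec3 ?P |- dec (fun x => ?P (@?f x) (@?g x) (@?h x)) =>
      apply (dec3_comp P f g h H); rec
  | H : dec2 ?P |- dec (fun x => ?P (@?f x) (@?g x)) => apply (dec2_comp P f g H); rec
  | H : dec ?P |- dec (fun x => ?P (@?f x)) => apply (dec_comp P f H); rec
  | |- dec (fun x => ?P (@?f x) (@?g x)) =>
      apply (dec2_comp P f g); [solve [auto with recdb] | rec | rec]
  end.

(** * Codes of finite sequences *)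

(** Works on the codes of [seq_code]. Since [pi2 0 = 0], the empty sequence is its own tail. *)
Definition seq_tail (s n : nat) : nat := Nat.iter n (fun s => pi2 (Nat.pred s)) s.

Definition entry (s n : nat) : nat := pi1 (Nat.pred (seq_tail s n)).

(** The bound loses nothing, as a sequence is no longer than its code, and it makes the predicate
    decidable. *)
Definition content (s x : nat) : Prop := exists n, n < s /\ entry s n = S x.

(** Entry 0 arises from a pause as well as beyond the end; the tests on [seq_tail] tell the two
    apart. *)
Definition extends (s r : nat) : Prop :=
  forall n, n < s -> seq_tail s n <> 0 -> seq_tail r n <> 0 /\ entry s n = entry r n.

Lemma rec_seq_tail : recursive2 seq_tail.
Proof.
refine (rec_ext _ _ _ (rec_nat_rect (fun a => a) (fun _ _ r => pi2 (Nat.pred r)) _ _)).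
- reflexivity.
- rec.
- rec.
Qed.
#[global] Hint Resolve rec_seq_tail : recdb.

Lemma rec_entry : recursive2 entry.
Proof. unfold recursive2, entry; rec. Qed.
#[global] Hint Resolve rec_entry : recdb.

Lemma dec_content : dec2 content.
Proof. unfold content; decide_pred. Qed.

Lemma dec_extends : dec2 extends.
Proof. unfold extends; decide_pred. Qed.
#[global] Hint Resolve dec_content dec_extends : recdb.

Lemma pi_zero : pi1 0 = 0 /\ pi2 0 = 0.
Proof. pose proof (pair_code_ge (pi1 0) (pi2 0)) as H; rewrite pair_pi in H; lia. Qed.

Lemma seq_code_surj s : exists l, seq_code l = s.
Proof.
induction s as [[ | s] IH] using lt_wf_ind; [now exists [] | ].
destruct (IH (pi2 s)) as [l Hl].
{ pose proof (pair_code_ge (pi1 s) (pi2 s)) as H; rewrite pair_pi in H; lia. }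
exists ((match pi1 s with 0 => None | S x => Some x end) :: l); simpl.
rewrite Hl; f_equal; rewrite <- (pair_pi s) at 3; f_equal.
now destruct (pi1 s).
Qed.

Lemma option_code_inj a b : option_code a = option_code b -> a = b.
Proof. destruct a, b; simpl; congruence. Qed.

Lemma seq_code_inj l l' : seq_code l = seq_code l' -> l = l'.
Proof.
revert l'; induction l as [ | a l IH]; intros [ | b l']; simpl; try congruence.
intros H; injection H as H; apply pair_code_inj in H as [H1 H2].
f_equal; [now apply option_code_inj | now apply IH].
Qed.

Lemma length_le_seq_code l : length l <= seq_code l.
Proof.
induction l as [ | a l IH]; simpl; [lia | ].
pose proof (pair_code_ge (option_code a) (seq_code l)); lia.
Qed.

Lemma seq_tail_spec l n : seq_tail (seq_code l) n = seq_code (skipn n l).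
Proof.
revert l; induction n as [ | n IH]; intros l; [reflexivity | ].
unfold seq_tail; rewrite Nat.iter_succ_r; fold (seq_tail (pi2 (Nat.pred (seq_code l))) n).
destruct l as [ | a l]; simpl.
- rewrite (proj2 pi_zero); change (seq_tail (seq_code []) n = seq_code []).
  now rewrite IH, skipn_nil.
- simp_pi; apply IH.
Qed.

Lemma entry_spec l n :
  entry (seq_code l) n = match nth_error l n with Some o => option_code o | None => 0 end.
Proof.
unfold entry; rewrite seq_tail_spec.
revert l; induction n as [ | n IH]; intros [ | a l]; simpl; simp_pi; auto; apply pi_zero.
Qed.

Lemma seq_tail_zero l n : seq_tail (seq_code l) n = 0 <-> nth_error l n = None.
Proof.
rewrite seq_tail_spec.
revert l; induction n as [ | n IH]; intros [ | a l]; simpl; auto; easy.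
Qed.

Lemma content_spec l x : content (seq_code l) x <-> In (Some x) l.
Proof.
split.
- intros (n & _ & Hn); rewrite entry_spec in Hn.
  destruct (nth_error l n) as [[y | ] | ] eqn:E; try discriminate.
  simpl in Hn; injection Hn as ->; eapply nth_error_In; eauto.
- intros H; apply In_nth_error in H as [n Hn].
  exists n; rewrite entry_spec, Hn; split; [ | reflexivity].
  pose proof (length_le_seq_code l).
  assert (n < length l) by (apply nth_error_Some; congruence); lia.
Qed.

Lemma content_lt s x : content s x -> x < s.
Proof.
destruct (seq_code_surj s) as [l <-]; rewrite content_spec.
induction l as [ | a l IH]; simpl; [easy | ].
pose proof (pair_code_ge (option_code a) (seq_code l)).
intros [-> | H1]; [simpl in *; lia | apply IH in H1; lia].
Qed.

Lemma extends_spec l r : extends (seq_code l) r <-> exists l', r = seq_code (l ++ l').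
Proof.
destruct (seq_code_surj r) as [k <-]; split.
- intros H.
  assert (H' : forall n, nth_error l n <> None -> nth_error l n = nth_error k n).
  { intros n Hn.
    assert (Hl : n < seq_code l).
    { apply nth_error_Some in Hn; pose proof (length_le_seq_code l); lia. }
    specialize (H n Hl); rewrite !seq_tail_zero, !entry_spec in H.
    destruct H as [H1 H2]; [exact Hn | ].
    destruct (nth_error l n), (nth_error k n); try easy.
    f_equal; now apply option_code_inj. }
  clear H; revert k H'; induction l as [ | a l IH]; intros k H; [now exists k | ].
  destruct k as [ | b k]; [now specialize (H 0); simpl in H; discriminate H | ].
  assert (E : Some a = Some b) by (apply (H 0); simpl; discriminate).
  injection E as <-.
  destruct (IH k) as [l' Hl']; [intros n; exact (H (S n)) | ].
  apply seq_code_inj in Hl' as ->; now exists l'.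
- intros [l' E]; apply seq_code_inj in E as ->.
  intros n _; rewrite !seq_tail_zero, !entry_spec; intros Hn.
  rewrite nth_error_app1 by (now apply nth_error_Some); auto.
Qed.

(** * Recursively enumerable predicates *)

(** A normal form theorem, by induction on programs: [t] records the intermediate values of a run
    together with the witnesses for the subprograms. *)
Lemma computes_sigma p :
  exists D, dec3 D /\ forall a y, computes p a y <-> exists t, D a y t.
Proof.
induction p as [ | | | | f (Df & Hf & Ef) g (Dg & Hg & Eg)
  | f (Df & Hf & Ef) g (Dg & Hg & Eg) | f (Df & Hf & Ef) g (Dg & Hg & Eg)
  | f (Df & Hf & Ef)]; simpl.
- exists (fun _ y _ => y = 0); split; [decide_pred | ].
  intros a y; split; [now exists 0 | now intros [_ H]].
- exists (fun a y _ => y = S a); split; [decide_pred | ].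
  intros a y; split; [now exists 0 | now intros [_ H]].
- exists (fun a y _ => y = pi1 a); split; [decide_pred | ].
  intros a y; split; [now exists 0 | now intros [_ H]].
- exists (fun a y _ => y = pi2 a); split; [decide_pred | ].
  intros a y; split; [now exists 0 | now intros [_ H]].
- exists (fun a y t => Df a (pi1 y) (pi1 t) /\ Dg a (pi2 y) (pi2 t)).
  split; [decide_pred | ].
  intros a y; split.
  + intros (u & v & Hu & Hv & ->).
    apply Ef in Hu as [t Ht]; apply Eg in Hv as [t' Ht'].
    exists (pair_code t t'); now simp_pi.
  + intros (t & Ht & Ht'); exists (pi1 y), (pi2 y).
    rewrite Ef, Eg, pair_pi; eauto.
- exists (fun a y t => Dg a (pi1 t) (pi1 (pi2 t)) /\ Df (pi1 t) y (pi2 (pi2 t))).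
  split; [decide_pred | ].
  intros a y; split.
  + intros (u & Hu & Hy).
    apply Eg in Hu as [t Ht]; apply Ef in Hy as [t' Ht'].
    exists (pair_code u (pair_code t t')); now simp_pi.
  + intros (t & Ht & Ht'); exists (pi1 t).
    rewrite Ef, Eg; eauto.
- (* [t] codes the list of the intermediate values and that of their witnesses *)
  exists (fun a y t =>
    Df (pi1 a) (item (pi1 t) 0) (item (pi2 t) 0) /\
    (forall k, k < pi2 a ->
       Dg (pair_code (pi1 a) (pair_code k (item (pi1 t) k)))
          (item (pi1 t) (S k)) (item (pi2 t) (S k))) /\
    y = item (pi1 t) (pi2 a)).
  split; [decide_pred | ].
  intros a; generalize (pi1 a) as b, (pi2 a) as n; clear a; intros b n y; split.
  + intros H.
    assert (HP : exists v, v n = y /\ computes f b (v 0) /\ forall k, k < n ->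
      computes g (pair_code b (pair_code k (v k))) (v (S k))).
    { revert y H; induction n as [ | n IH]; simpl; intros y H.
      - exists (fun _ => y); repeat split; [exact H | lia].
      - destruct H as (r & Hr & Hy).
        destruct (IH r Hr) as (v & <- & H0 & HS).
        exists (fun k => if Nat.leb k n then v k else y); split; [ | split].
        + now rewrite (proj2 (Nat.leb_gt _ _)) by lia.
        + exact H0.
        + intros k Hk.
          rewrite (proj2 (Nat.leb_le k n)) by lia.
          destruct (Nat.eq_dec k n) as [-> | Hn].
          * now rewrite (proj2 (Nat.leb_gt _ _)) by lia.
          * rewrite (proj2 (Nat.leb_le _ _)) by lia; apply HS; lia. }
    destruct HP as (v & <- & H0 & HS).
    destruct (item_choice (fun j x => x = v j) (S n)) as [l Hl]; [eauto | ].
    destruct (item_choice (fun j t => match j with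
        | 0 => Df b (v 0) t
        | S k => Dg (pair_code b (pair_code k (v k))) (v (S k)) t
        end) (S n)) as [l' Hl'].
    { intros [ | k] Hk; [now apply Ef | apply Eg, HS; lia]. }
    exists (pair_code l l'); simp_pi; repeat split.
    * rewrite Hl by lia; apply (Hl' 0); lia.
    * intros k Hk; rewrite !Hl by lia; apply (Hl' (S k)); lia.
    * now rewrite Hl by lia.
  + intros (t & H0 & HS & ->).
    induction n as [ | n IH]; simpl; [apply Ef; eauto | ].
    exists (item (pi1 t) n); split; [apply IH; intros; apply HS; lia | ].
    apply Eg; eauto.
- exists (fun a y t =>
    Df (pair_code a y) 0 (pi1 t) /\
    (forall m, m < y -> Df (pair_code a m) (S (item (pi1 (pi2 t)) m))
                           (item (pi2 (pi2 t)) m))).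
  split; [decide_pred | ].
  intros a y; split.
  + intros (H0 & HS); apply Ef in H0 as [t Ht].
    destruct (item_choice (fun m k => computes f (pair_code a m) (S k)) y HS) as [l Hl].
    destruct (item_choice (fun m => Df (pair_code a m) (S (item l m))) y) as [l' Hl'].
    { intros m Hm; apply Ef, Hl, Hm. }
    exists (pair_code t (pair_code l l')); simp_pi; auto.
  + intros (t & H0 & HS); split; [apply Ef; eauto | ].
    intros m Hm; eexists; apply Ef; eauto.
Qed.

(** [Mu] applied to the program deciding [D] halts exactly if there is a witness. *)
Lemma re_of_dec D : dec2 D -> re (fun x => exists t, D x t).
Proof.
intros (f & [p Hp] & HD); exists (Mu p); intros x; simpl.
assert (E : forall t, D x t <-> f (pair_code x t) = 0).
{ intros t; specialize (HD (pair_code x t)); simp_pi; exact HD. }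
split.
- intros [t0 Ht0].
  destruct (dec_inh_nat_subset_has_unique_least_element (fun t => f (pair_code x t) = 0))
    as (t & (Ht & Hm) & _).
  { intros; apply classic. }
  { exists t0; now apply E. }
  exists t; split; [rewrite <- Ht; apply Hp | ].
  intros m Hmt; exists (Nat.pred (f (pair_code x m))).
  replace (S _) with (f (pair_code x m)); [apply Hp | ].
  destruct (f (pair_code x m)) eqn:Em; [apply Hm in Em; lia | reflexivity].
- intros (t & Ht & _); exists t; apply E.
  eapply computes_functional; [apply Hp | exact Ht].
Qed.

Lemma re_witness A : re A -> exists D, dec2 D /\ forall x, A x <-> exists t, D x t.
Proof.
intros [p Hp]; destruct (computes_sigma p) as (D & HD & E).
exists (fun x t => D x (pi1 t) (pi2 t)); split; [decide_pred | ].
intros x; rewrite Hp; split.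
- intros [y Hy]; apply E in Hy as [t Ht]; exists (pair_code y t); now simp_pi.
- intros [t Ht]; exists (pi1 t); apply E; eauto.
Qed.

Lemma re_ext A B : (forall x, A x <-> B x) -> re A -> re B.
Proof. intros E [p Hp]; exists p; intros x; rewrite <- E; apply Hp. Qed.

Lemma re_dec A : dec A -> re A.
Proof.
intros HA; apply re_ext with (fun x => exists _ : nat, A x).
- intros x; split; [now intros [] | now exists 0].
- apply re_of_dec, (dec_comp A); [exact HA | rec].
Qed.

Definition re3 (R : nat -> nat -> nat -> Prop) : Prop :=
  re (fun z => R (pi1 z) (pi1 (pi2 z)) (pi2 (pi2 z))).

Lemma re_comp A f : re A -> recursive f -> re (fun x => A (f x)).
Proof.
intros HA Hf; destruct (re_witness A HA) as (D & HD & E).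
apply re_ext with (fun x => exists t, D (f x) t); [intros x; now rewrite E | ].
apply re_of_dec; decide_pred.
Qed.

Lemma re2_comp R f g :
  re2 R -> recursive f -> recursive g -> re (fun x => R (f x) (g x)).
Proof.
intros HR Hf Hg.
refine (re_ext _ _ _ (re_comp _ (fun x => pair_code (f x) (g x)) HR _)); [ | rec].
intros x; cbv beta; now simp_pi.
Qed.

Lemma re3_comp R f g h :
  re3 R -> recursive f -> recursive g -> recursive h ->
  re (fun x => R (f x) (g x) (h x)).
Proof.
intros HR Hf Hg Hh.
refine (re_ext _ _ _
  (re_comp _ (fun x => pair_code (f x) (pair_code (g x) (h x))) HR _)); [ | rec].
intros x; cbv beta; now simp_pi.
Qed.

Lemma re_and A B : re A -> re B -> re (fun x => A x /\ B x).
Proof.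
intros HA HB.
destruct (re_witness A HA) as (D & HD & E), (re_witness B HB) as (D' & HD' & E').
apply re_ext with (fun x => exists t, D x (pi1 t) /\ D' x (pi2 t)).
- intros x; rewrite E, E'; split.
  + intros (t & Ht & Ht'); eauto.
  + intros [[t Ht] [t' Ht']]; exists (pair_code t t'); now simp_pi.
- apply re_of_dec; decide_pred.
Qed.

Lemma re_or A B : re A -> re B -> re (fun x => A x \/ B x).
Proof.
intros HA HB.
destruct (re_witness A HA) as (D & HD & E), (re_witness B HB) as (D' & HD' & E').
apply re_ext with (fun x => exists t, D x t \/ D' x t).
- intros x; rewrite E, E'; firstorder.
- apply re_of_dec; decide_pred.
Qed.

Lemma re_ex R : re2 R -> re (fun x => exists y, R x y).
Proof.
intros HR; destruct (re_witness _ HR) as (D & HD & E).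
apply re_ext with (fun x => exists t, D (pair_code x (pi1 t)) (pi2 t)).
- intros x; split.
  + intros [t Ht]; exists (pi1 t).
    pose proof (proj2 (E _) (ex_intro _ _ Ht)) as H; cbv beta in H; now simp_pi.
  + intros [y Hy]; assert (Hxy : exists t, D (pair_code x y) t) by (apply E; now simp_pi).
    destruct Hxy as [t Ht]; exists (pair_code y t); now simp_pi.
- apply re_of_dec; decide_pred.
Qed.

Lemma re_all_lt R b :
  re2 R -> recursive b -> re (fun x => forall y, y < b x -> R x y).
Proof.
intros HR Hb; destruct (re_witness _ HR) as (D & HD & E).
assert (E' : forall x y, R x y <-> exists t, D (pair_code x y) t).
{ intros x y; rewrite <- E; now simp_pi. }
apply re_ext with (fun x => exists t, forall y, y < b x -> D (pair_code x y) (item t y)).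
- intros x; split.
  + intros [t Ht] y Hy; apply E'; eauto.
  + intros H; apply (item_choice (fun y => D (pair_code x y))).
    intros y Hy; apply E', H, Hy.
- apply re_of_dec; decide_pred.
Qed.

(** The elements of a sequence are smaller than its code and [content] is decidable, so the
    condition becomes a bounded quantifier over a disjunction. *)
Lemma re_content_sub R f :
  re2 R -> recursive f -> re (fun x => forall y, content (f x) y -> R x y).
Proof.
intros HR Hf.
apply re_ext with (fun x => forall y, y < f x -> ~ content (f x) y \/ R x y).
- intros x; split.
  + intros H y Hy; destruct (H y) as [Hn | HRy]; [now apply content_lt | easy | easy].
  + intros H y _; destruct (classic (content (f x) y)); auto.
- apply re_all_lt; [ | exact Hf].
  apply re_or; [apply re_dec; decide_pred | apply re2_comp; [exact HR | rec | rec]].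
Qed.

(** Negations and implications have no case of their own: they have to lie in a decidable part,
    which is left to [decide_pred]. *)
Ltac enum :=
  lazymatch goal with
  | |- re2 _ => unfold re2; enum
  | |- re3 _ => unfold re3; enum
  | |- re (fun x => @?P x /\ @?Q x) => apply (re_and P Q); enum
  | |- re (fun x => @?P x \/ @?Q x) => apply (re_or P Q); enum
  | |- re (fun x => forall y, content (@?f x) y -> @?P x y) =>
      apply (re_content_sub P f); [enum | rec]
  | |- re (fun x => forall y, y < @?b x -> @?P x y) =>
      apply (re_all_lt P b); [enum | rec]
  | |- re (fun x => exists y, @?P x y) => apply (re_ex P); enum
  | H : re3 ?P |- re (fun x => ?P (@?f x) (@?g x) (@?h x)) =>
      apply (re3_comp P f g h H); rec
  | H : re2 ?P |- re (fun x => ?P (@?f x) (@?g x)) => apply (re2_comp P f g H); rec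
  | H : re ?P |- re (fun x => ?P (@?f x)) => apply (re_comp P f H); rec
  | |- _ => first [ solve [apply re_dec; decide_pred]
      | lazymatch goal with
        | |- re (fun x => ?P (@?f x) (@?g x) (@?h x)) =>
            apply (re3_comp P f g h); [solve [auto with recdb] | rec | rec | rec]
        | |- re (fun x => ?P (@?f x) (@?g x)) =>
            apply (re2_comp P f g); [solve [auto with recdb] | rec | rec]
        end ]
  end.

Lemma re2_witness R :
  re2 R -> exists D, dec3 D /\ forall x y, R x y <-> exists t, D x y t.
Proof.
intros HR; destruct (re_witness _ HR) as (D & HD & E).
exists (fun x y t => D (pair_code x y) t); split; [decide_pred | ].
intros x y; rewrite <- E; now simp_pi.
Qed.

Lemma least_exists (P : nat -> Prop) :
  (exists n, P n) -> exists n, P n /\ forall m, m < n -> ~ P m.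
Proof.
intros [n0 H0]; induction n0 as [n0 IH] using lt_wf_ind.
destruct (classic (exists m, m < n0 /\ P m)) as [(m & Hm & HP) | H].
- exact (IH m Hm HP).
- exists n0; split; [exact H0 | intros m Hm HP; eauto].
Qed.

(* Any witness that all smaller candidates fail makes the choice of the least
   one co-r.e.; taking the least such witness makes it unique. *)
Lemma corec_unique_choice (Bad : nat -> nat -> Prop) :
  re2 Bad -> (forall m, exists v, ~ Bad m v) ->
  exists Dead, re2 Dead /\ (forall m, exists z, ~ Dead m z) /\
    (forall m z z', ~ Dead m z -> ~ Dead m z' -> z = z') /\
    (forall m z, ~ Dead m z -> ~ Bad m (pi1 z)).
Proof.
intros HBad Hex; destruct (re2_witness _ HBad) as (D & HD & E).
pose (Small := fun m v t => forall v', v' < v -> exists r, r < t /\ D m v' r).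
assert (HSmall : dec3 Small) by (unfold Small; decide_pred).
(* [z] codes [<v,t>]; the surviving [z] has the least good [v], and the least [t] below which every
   [v' < v] has a witness of its badness. *)
exists (fun m z => Bad m (pi1 z) \/
  ~ (Small m (pi1 z) (pi2 z) /\ forall t, t < pi2 z -> ~ Small m (pi1 z) t)).
split; [enum | ]; split; [ | split].
- intros m; destruct (least_exists _ (Hex m)) as (v & Hv & Hmin).
  assert (HS : exists t, Small m v t).
  { clear Hv; induction v as [ | v IH].
    - exists 0; intros v'; lia.
    - destruct IH as [t Ht]; [intros; apply Hmin; lia | ].
      destruct (proj1 (E m v)) as [r Hr]; [apply NNPP, Hmin; lia | ].
      exists (S (t + r)); intros v' Hv'.
      destruct (Nat.eq_dec v' v) as [-> | Hne].
      + exists r; split; [lia | exact Hr].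
      + destruct (Ht v') as (r' & ? & ?); [lia | exists r'; split; [lia | assumption]]. }
  destruct (least_exists _ HS) as (t & Ht & Htmin).
  exists (pair_code v t); simp_pi; tauto.
- intros m z z' Hz Hz'.
  apply not_or_and in Hz as [Hz1 Hz2], Hz' as [Hz1' Hz2'].
  apply NNPP in Hz2 as [S1 M1], Hz2' as [S2 M2].
  assert (Ev : pi1 z = pi1 z').
  { destruct (Nat.lt_trichotomy (pi1 z) (pi1 z')) as [H | [H | H]]; [ | exact H | ].
    - destruct (S2 _ H) as (r & _ & Hr); elim Hz1; apply E; eauto.
    - destruct (S1 _ H) as (r & _ & Hr); elim Hz1'; apply E; eauto. }
  rewrite <- (pair_pi z), <- (pair_pi z'); f_equal; [exact Ev | ].
  rewrite Ev in S1, M1.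
  destruct (Nat.lt_trichotomy (pi2 z) (pi2 z')) as [H | [H | H]]; [ | exact H | ].
  + now elim (M2 _ H).
  + now elim (M1 _ H).
- tauto.
Qed.

(** * Locking sequences *)

Lemma initial_app T n k : initial T (n + k) = initial T n ++ map T (seq n k).
Proof. unfold initial; now rewrite seq_app, map_app. Qed.

Lemma In_initial T n o : In o (initial T n) <-> exists k, k < n /\ T k = o.
Proof.
unfold initial; rewrite in_map_iff; split.
- intros (k & Hk & Hin); apply in_seq in Hin; exists k; split; [lia | exact Hk].
- intros (k & Hk & Hin); exists k; split; [exact Hin | apply in_seq; lia].
Qed.

Lemma length_initial T n : length (initial T n) = n.
Proof. unfold initial; now rewrite length_map, length_seq. Qed.

(** A relation on codes, so that a learner can also be given by an r.e. set of the numbering [W]. *)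
Definition graph (M : learner) (r v : nat) : Prop :=
  exists l, r = seq_code l /\ v = option_code (M l).

Definition locks (G : nat -> nat -> Prop) (L : nset) (s N : nat) : Prop :=
  (forall x, content s x -> L x) /\
  forall r v, extends s r -> (forall x, content r x -> L x) -> G r v -> v <= N.

(** After [l], position [length l + x] shows [x] or a pause according to [L x]. This is decided
    classically: texts need not be recursive. *)
Definition text_from (l : list (option nat)) (L : nset) (n : nat) : option nat :=
  if Nat.ltb n (length l) then nth n l None
  else if excluded_middle_informative (L (n - length l)) then Some (n - length l)
  else None.

Lemma text_from_is_text l L :
  (forall x, In (Some x) l -> L x) -> is_text (text_from l L) L.
Proof.
intros Hl x; split.
- intros Hx; exists (length l + x); unfold text_from.
  rewrite (proj2 (Nat.ltb_ge _ _)) by lia.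
  replace (length l + x - length l) with x by lia.
  now destruct (excluded_middle_informative (L x)).
- intros [n Hn]; unfold text_from in Hn.
  destruct (Nat.ltb_spec n (length l)) as [Hlt | Hge].
  + apply Hl; rewrite <- Hn; now apply nth_In.
  + destruct (excluded_middle_informative _); [now injection Hn as <- | discriminate].
Qed.

Lemma initial_text_from l L n :
  length l <= n -> exists l', initial (text_from l L) n = l ++ l'.
Proof.
intros Hn; replace n with (length l + (n - length l)) by lia.
rewrite initial_app; eexists; f_equal.
apply nth_ext with (d := None) (d' := None); [apply length_initial | ].
rewrite length_initial; intros k Hk.
unfold initial; rewrite (nth_indep _ None (text_from l L 0))
  by (rewrite length_map, length_seq; exact Hk).
rewrite map_nth, seq_nth by exact Hk; unfold text_from; simpl.
now rewrite (proj2 (Nat.ltb_lt _ _)).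
Qed.

(** If no pair is locking, every sequence over [L] has extensions over [L] with arbitrarily large
    outputs. Alternating such extensions with the entries of a text for [L] gives a text on which
    the outputs are unbounded. *)
Lemma locks_exists M L :
  (forall T, is_text T L ->
     exists N, forall n, 1 <= n -> option_code (M (initial T n)) <= N) ->
  exists s N, locks (graph M) L s N.
Proof.
intros HM; apply NNPP; intros Hno.
set (Over := fun l => forall x, In (Some x) l -> L x).
assert (Step : forall l N, Over l ->
  exists l', Over (l ++ l') /\ N < option_code (M (l ++ l'))).
{ intros l N Hl; apply NNPP; intros Hl'; apply Hno.
  exists (seq_code l), N; split; [intros x; rewrite content_spec; apply Hl | ].
  intros r v Hr Hov (k & -> & ->).
  apply extends_spec in Hr as [l' E]; apply seq_code_inj in E as ->.
  apply Nat.nlt_ge; intros Hlt; apply Hl'; exists l'; split; [ | exact Hlt].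
  intros x Hx; apply Hov; now rewrite content_spec. }
set (T0 := text_from [] L).
assert (HT0 : is_text T0 L) by (now apply text_from_is_text).
pose (next := fun n l => l ++ epsilon (inhabits [])
  (fun l' => Over (l ++ l') /\ n < option_code (M (l ++ l'))) ++ [T0 n]).
pose (st := fix st n := match n with 0 => [] | S n => next n (st n) end).
assert (Hst : forall n, Over (st n)).
{ intros n; induction n as [ | n IH]; [intros x [] | ].
  simpl; unfold next; set (e := epsilon _ _).
  pose proof (epsilon_spec (inhabits []) _ (Step (st n) n IH)) as [He _]; fold e in He.
  intros x Hx; rewrite app_assoc, in_app_iff in Hx; destruct Hx as [Hx | [Hx | []]].
  - now apply He.
  - apply HT0; eauto. }
assert (Hpre : forall n k, exists l', st (n + k) = st n ++ l').
{ intros n k; induction k as [ | k [l' IH]].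
  - exists []; now rewrite Nat.add_0_r, app_nil_r.
  - rewrite Nat.add_succ_r; simpl; unfold next at 1; rewrite IH.
    eexists; now rewrite <- app_assoc. }
assert (Hlen : forall n, n <= length (st n)).
{ induction n as [ | n IH]; simpl; [lia | ].
  unfold next; rewrite !length_app; simpl; lia. }
(* The stages are nested and [st (S k)] has more than [k] entries, so the default [None] is never
   reached. *)
pose (T := fun k => nth k (st (S k)) None).
assert (HT : forall k n, k < length (st n) -> nth k (st n) None = T k).
{ intros k n Hk; unfold T; pose proof (Hlen (S k)) as Hk'.
  destruct (Nat.le_ge_cases n (S k)) as [H | H].
  - destruct (Hpre n (S k - n)) as [l' E].
    replace (n + (S k - n)) with (S k) in E by lia.
    rewrite E, app_nth1; auto.
  - destruct (Hpre (S k) (n - S k)) as [l' E].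
    replace (S k + (n - S k)) with n in E by lia.
    rewrite E, app_nth1; auto; lia. }
assert (HTi : forall l l' n, st n = l ++ l' -> initial T (length l) = l).
{ intros l l' n E; apply nth_ext with (d := T 0) (d' := None); [apply length_initial | ].
  rewrite length_initial; intros k Hk; unfold initial.
  rewrite map_nth, seq_nth by exact Hk; simpl.
  rewrite <- (HT k n), E; [now apply app_nth1 | ].
  rewrite E, length_app; lia. }
assert (Text : is_text T L).
{ intros x; split.
  - intros Hx; apply HT0 in Hx as [n Hn].
    exists (length (st (S n)) - 1); rewrite <- HT with (n := S n).
    + simpl; unfold next; rewrite app_assoc, length_app, Nat.add_sub.
      now rewrite nth_middle.
    + pose proof (Hlen (S n)); lia.
  - intros [n Hn]; apply (Hst (S n)); rewrite <- Hn; apply nth_In, Hlen. }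
destruct (HM T Text) as [N HN].
(* Stage [S N] instead of [N] ensures a nonempty segment, as the bound [HN] starts at length 1. *)
pose proof (epsilon_spec (inhabits []) _ (Step (st (S N)) (S N) (Hst (S N)))) as [_ Hout].
set (e := epsilon _ _) in Hout.
assert (E : st (S (S N)) = (st (S N) ++ e) ++ [T0 (S N)]).
{ rewrite <- app_assoc; reflexivity. }
rewrite <- (HTi _ _ _ E) in Hout.
assert (1 <= length (st (S N) ++ e)) as H1
  by (rewrite length_app; pose proof (Hlen (S N)); lia).
apply HN in H1; lia.
Qed.

(** On a text for [L'] beginning with [s], the later initial segments extend [s] over [L], so the
    outputs stay below the bound while becoming correct for [L']. *)
Lemma locks_hypothesis W eta M C L L' s N :
  bc_learns W eta M C -> C L' -> locks (graph M) L s N ->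
  (forall x, content s x -> L' x) -> (forall x, L' x -> L x) ->
  exists e, e <= N /\ same_set (eta_closure eta (W e)) L'.
Proof.
intros HM HL' [_ Hlock] Hs Hsub.
destruct (seq_code_surj s) as [l <-].
assert (HT : is_text (text_from l L') L').
{ apply text_from_is_text; intros x; rewrite <- content_spec; apply Hs. }
destruct (HM L' HL' _ HT) as [n0 Hn0].
destruct (Hn0 (n0 + length l)) as (e & He & Heq); [lia | ].
exists e; split; [ | exact Heq].
(* [S e] is the code of the output [Some e]. *)
assert (S e <= N); [ | lia].
apply (Hlock (seq_code (initial (text_from l L') (n0 + length l)))).
- destruct (initial_text_from l L' (n0 + length l)) as [l' E]; [lia | ].
  rewrite E; apply extends_spec; eauto.
- intros x Hx; apply Hsub, HT; apply content_spec, In_initial in Hx as (k & _ & Hk); eauto.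
- eexists; split; [reflexivity | ]; now rewrite He.
Qed.

Lemma vac_bounded (M : learner) T :
  (exists l, forall n, 1 <= n -> In (M (initial T n)) l) ->
  exists N, forall n, 1 <= n -> option_code (M (initial T n)) <= N.
Proof.
intros [l Hl].
assert (HN : exists N, forall o, In o l -> option_code o <= N).
{ clear Hl; induction l as [ | a l [N IH]]; [now exists 0 | ].
  exists (option_code a + N); intros o [<- | Ho]; [lia | ].
  apply IH in Ho; lia. }
destruct HN as [N HN]; exists N; auto.
Qed.

Lemma graph_re M : recursive_learner M -> re2 (graph M).
Proof.
intros [p Hp]; destruct (computes_sigma p) as (D & HD & E).
apply re_ext with (fun z => exists t, D (pi1 z) (pi2 z) t); [ | enum].
intros z; rewrite <- E; split.
- intros H; destruct (seq_code_surj (pi1 z)) as [l Hl].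
  exists l; split; [easy | ].
  eapply computes_functional; [exact H | rewrite <- Hl; apply Hp].
- intros (l & -> & ->); apply Hp.
Qed.

(** Induction on [N]: if the value [S N] serves some [y0], it serves no other number, and beyond
    [y0] only the smaller values remain. *)
Lemma unbounded_pigeonhole (P : nat -> Prop) (R : nat -> nat -> Prop) N :
  (forall n, exists y, n <= y /\ P y) ->
  (forall y, P y -> exists e, e <= N /\ R e y) ->
  (forall e y y', P y -> P y' -> R e y -> R e y' -> y = y') -> False.
Proof.
revert P; induction N as [ | N IH]; intros P HP HR Hinj.
- destruct (HP 0) as (y & _ & Hy), (HP (S y)) as (y' & Hy' & HPy').
  destruct (HR y Hy) as (e & He & He'), (HR y' HPy') as (e' & He1 & He1').
  replace e' with e in * by lia.
  specialize (Hinj e y y'); intuition lia.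
- destruct (classic (exists y, P y /\ R (S N) y)) as [(y0 & Hy0 & HR0) | Hno].
  + apply (IH (fun y => P y /\ y0 < y)).
    * intros n; destruct (HP (n + S y0)) as (y & Hy & HPy); exists y; intuition lia.
    * intros y [HPy Hlt]; destruct (HR y HPy) as (e & He & HRe).
      exists e; split; [ | exact HRe].
      destruct (Nat.eq_dec e (S N)) as [-> | ]; [ | lia].
      specialize (Hinj (S N) y y0 HPy Hy0 HRe HR0); lia.
    * intros e y y' [] []; eauto.
  + apply (IH P HP); [ | exact Hinj].
    intros y HPy; destruct (HR y HPy) as (e & He & HRe).
    exists e; split; [ | exact HRe].
    destruct (Nat.eq_dec e (S N)) as [-> | ]; [ | lia].
    elim Hno; eauto.
Qed.

(** * Families of closed sets of a positive equivalence *)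

(** The least number outside the classes of [l], chosen by [epsilon] since it is not computable in
    general. *)
Definition fresh_rep (eta : nat -> nat -> Prop) (l : list nat) : nat :=
  epsilon (inhabits 0) (fun x =>
    (forall y, In y l -> ~ eta y x) /\
    forall z, z < x -> exists y, In y l /\ eta y z).

Fixpoint reps (eta : nat -> nat -> Prop) (n : nat) : list nat :=
  match n with
  | 0 => []
  | S n => fresh_rep eta (reps eta n) :: reps eta n
  end.

(* The least elements of the classes, in increasing order. *)
Definition rep (eta : nat -> nat -> Prop) (n : nat) : nat := fresh_rep eta (reps eta n).

Definition chain (eta : nat -> nat -> Prop) (m x : nat) : Prop :=
  exists j, j < m /\ eta (rep eta j) x.

Definition saturated (eta : nat -> nat -> Prop) (A : nset) : Prop :=
  forall x y, eta x y -> A x -> A y.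

(** For a saturated [A], the first omitted class is number [m]. This invariant separates the columns
    and lets a learner find [m] in the limit. *)
Definition misses (eta : nat -> nat -> Prop) (m : nat) (A : nset) : Prop :=
  (forall x, x < rep eta m -> A x) /\ ~ A (rep eta m).

Section Positive.

Context (eta : nat -> nat -> Prop) (heta : positive_equivalence eta).

Let eta_refl x : eta x x.
Proof. apply heta. Qed.

Let eta_sym x y : eta x y -> eta y x.
Proof. apply heta. Qed.

Let eta_trans x y z : eta x y -> eta y z -> eta x z.
Proof. apply heta. Qed.

Let eta_re : re2 eta.
Proof. apply heta. Qed.

Lemma In_reps n y : In y (reps eta n) <-> exists j, j < n /\ y = rep eta j.
Proof.
induction n as [ | n IH]; simpl.
- split; [easy | intros (j & ? & _); lia].
- rewrite IH; split.
  + intros [<- | (j & Hj & ->)]; [exists n | exists j]; split; auto; lia.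
  + intros (j & Hj & ->); destruct (Nat.eq_dec j n) as [-> | ]; [now left | right].
    exists j; split; [lia | reflexivity].
Qed.

Lemma rep_spec m :
  (forall j, j < m -> ~ eta (rep eta j) (rep eta m)) /\
  (forall x, x < rep eta m -> chain eta m x).
Proof.
assert (H : exists x, forall y, In y (reps eta m) -> ~ eta y x).
{ apply NNPP; intros H; apply heta; exists (reps eta m); intros x.
  apply NNPP; intros Hx; apply H; exists x; intros y Hy Hyx; eauto. }
destruct (least_exists _ H) as (x & Hx & Hmin).
assert (Hs := epsilon_spec (inhabits 0) (fun x =>
    (forall y, In y (reps eta m) -> ~ eta y x) /\
    forall z, z < x -> exists y, In y (reps eta m) /\ eta y z)).
destruct Hs as [H1 H2].
{ exists x; split; [exact Hx | intros z Hz].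
  apply NNPP; intros Hn; apply (Hmin z Hz); intros y Hy Hyz; eauto. }
split.
- intros j Hj; apply H1, In_reps; eauto.
- intros z Hz; destruct (H2 z Hz) as (y & Hy & Hyz).
  apply In_reps in Hy as (j & Hj & ->); exists j; auto.
Qed.

Lemma rep_lt j m : j < m -> rep eta j < rep eta m.
Proof.
intros Hj; destruct (Nat.lt_trichotomy (rep eta j) (rep eta m)) as [H | [H | H]]; auto.
- elim (proj1 (rep_spec m) j Hj); rewrite H; apply eta_refl.
- apply rep_spec in H as (i & Hi & Him).
  elim (proj1 (rep_spec m) i); [lia | exact Him].
Qed.

Lemma rep_ge m : m <= rep eta m.
Proof.
induction m as [ | m IH]; [lia | ].
pose proof (rep_lt m (S m)); lia.
Qed.

Lemma rep_least x m : eta x (rep eta m) -> rep eta m <= x.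
Proof.
intros Hx; apply Nat.nlt_ge; intros Hlt.
apply rep_spec in Hlt as (j & Hj & Hjx).
apply (proj1 (rep_spec m) j Hj); eauto.
Qed.

Lemma rep_not_chain m : ~ chain eta m (rep eta m).
Proof. intros (j & Hj & H); now apply (proj1 (rep_spec m) j Hj). Qed.

Lemma chain_saturated m : saturated eta (chain eta m).
Proof. intros x y Hxy (j & Hj & H); exists j; eauto. Qed.

Lemma chain_rep j m : j < m -> chain eta m (rep eta j).
Proof. intros H; exists j; auto. Qed.

Lemma chain_lt x m : x < m -> chain eta m x.
Proof. intros H; apply rep_spec; pose proof (rep_ge m); lia. Qed.

Lemma chain_misses m : misses eta m (chain eta m).
Proof. split; [apply rep_spec | apply rep_not_chain]. Qed.

Lemma least_of_class x : exists y, eta y x /\ forall z, z < y -> ~ eta z y.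
Proof.
destruct (least_exists (fun y => eta y x)) as (y & Hy & Hm); [eauto | ].
exists y; split; [exact Hy | intros z Hz Hzy; apply (Hm z Hz); eauto].
Qed.

Lemma least_eq x y :
  (forall z, z < x -> ~ eta z x) -> (forall z, z < y -> ~ eta z y) -> eta x y -> x = y.
Proof.
intros Hx Hy Hxy; destruct (Nat.lt_trichotomy x y) as [H | [H | H]]; auto.
- now elim (Hy x H).
- elim (Hx y H); auto.
Qed.

Lemma misses_unique m m' A :
  saturated eta A -> misses eta m A -> misses eta m' A -> m = m'.
Proof.
intros HA [H1 H2] [H1' H2'].
destruct (Nat.lt_trichotomy m m') as [H | [H | H]]; auto.
- elim H2; apply H1', rep_lt, H.
- elim H2'; apply H1, rep_lt, H.
Qed.

Lemma misses_ext m A B : same_set A B -> misses eta m A -> misses eta m B.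
Proof.
intros E [H1 H2]; split; [intros x Hx; apply E; auto | ].
intros H; apply H2, E, H.
Qed.

(* [rep eta] is only limit recursive: one compares numbers of classes instead. *)
Lemma chain_re : re2 (chain eta).
Proof.
apply re_ext with (fun z => exists y, eta y (pi2 z) /\
  exists l, forall x, x < S y -> exists j, j < pi1 z /\ eta (item l j) x).
2: enum.
intros z; generalize (pi1 z) as m, (pi2 z) as x; clear z; intros m x; split.
- intros (y & Hyx & l & Hl).
  apply NNPP; intros Hx.
  assert (Hy : ~ chain eta m y).
  { intros Hy; apply Hx; now apply (chain_saturated m y). }
  (* If [y] were outside the first [m] classes, the [m + 1] inequivalent numbers [rep eta 0], ...,
     [rep eta m] would all be at most [y] and hence lie in the [m] classes listed by [l]. *)
  assert (Hle : forall j, j <= m -> rep eta j <= y).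
  { intros j Hj; apply Nat.nlt_ge; intros Hlt; apply Hy.
    apply rep_spec in Hlt as (i & Hi & Hiy); exists i; split; [lia | exact Hiy]. }
  destruct (item_choice (fun i j => j < m /\ eta (item l j) (rep eta i)) (S m))
    as [k Hk].
  { intros i Hi; apply Hl; specialize (Hle i); lia. }
  assert (Hnd : NoDup (map (item k) (seq 0 (S m)))).
  { apply NoDup_map_NoDup_ForallPairs; [ | apply seq_NoDup].
    intros i i' Hi Hi' E; apply in_seq in Hi, Hi'.
    destruct (Hk i) as [_ H]; [lia | ]; destruct (Hk i') as [_ H']; [lia | ].
    rewrite E in H.
    destruct (Nat.lt_trichotomy i i') as [Hlt | [-> | Hlt]]; [ | reflexivity | ].
    - elim (proj1 (rep_spec i') i Hlt); eauto.
    - elim (proj1 (rep_spec i) i' Hlt); eauto. }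
  apply NoDup_incl_length with (l' := seq 0 m) in Hnd.
  + rewrite length_map, !length_seq in Hnd; lia.
  + intros j Hj; apply in_map_iff in Hj as (i & <- & Hi); apply in_seq in Hi.
    apply in_seq; destruct (Hk i); lia.
- intros (j & Hj & Hjx); exists (rep eta j); split; [exact Hjx | ].
  destruct (item_choice (fun i y => y = rep eta i) m) as [l Hl]; [eauto | ].
  exists l; intros z Hz.
  destruct (Nat.eq_dec z (rep eta j)) as [-> | Hne].
  + exists j; rewrite Hl by exact Hj; auto.
  + assert (Hz' : z < rep eta j) by lia.
    apply rep_spec in Hz' as (i & Hi & Hiz); exists i; rewrite Hl by lia.
    split; [lia | exact Hiz].
Qed.

Let closure_saturated A : saturated eta (eta_closure eta A).
Proof. intros x y Hxy (z & Hz & Hzx); exists z; eauto. Qed.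

(* A member [K] found to be bad is enlarged to a member of [chain eta] that
   contains the finite part enumerated so far and is used by no other [K].  Odd
   lengths from 3 on differ from the one or two classes of [two_classes] and from
   the even columns below. *)
Lemma repaired_family (Core : nat -> nat -> Prop) (Bad : nat -> Prop) :
  re2 Core -> re Bad ->
  (forall K K', ~ Bad K -> ~ Bad K' ->
     same_set (eta_closure eta (Core K)) (eta_closure eta (Core K')) -> K = K') ->
  (forall K j, ~ Bad K ->
     ~ same_set (eta_closure eta (Core K)) (chain eta (S (S (S (j + j)))))) ->
  exists C, eta_family eta C /\
    (forall K L, ~ Bad K -> same_set L (eta_closure eta (Core K)) -> C L) /\
    (forall L, C L ->
       (exists K, ~ Bad K /\ same_set L (eta_closure eta (Core K))) \/
       (exists j, same_set L (chain eta (S (S (S (j + j))))))).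
Proof.
intros HCore HBad Hinj Hchain.
destruct (re2_witness _ HCore) as (D & HD & ED).
destruct (re_witness _ HBad) as (F & HF & EF).
pose proof chain_re as Hch.
pose (odd_chain := fun K s => chain eta (S (S (S (pair_code K s + pair_code K s))))).
(* The core is enumerated while no witness of badness has appeared; the least witness [s] switches
   to a chain whose length encodes both [K] and [s]. *)
pose (B := fun K x =>
  (exists y, eta y x /\ exists t, (exists u, u < t /\ D K y u) /\ y < t /\
     (forall s, s < S t -> ~ F K s)) \/
  (exists s, F K s /\ (forall s', s' < s -> ~ F K s') /\
     chain eta (S (S (S (pair_code K s + pair_code K s)))) x)).
assert (HB : re2 B) by (unfold B; enum).
assert (Good : forall K, ~ Bad K -> same_set (B K) (eta_closure eta (Core K))).
{ intros K HK x.
  assert (HFK : forall s, ~ F K s) by (intros s Hs; apply HK, EF; eauto).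
  split.
  - intros [(y & Hyx & t & (u & _ & Hu) & _) | (s & Hs & _)]; [ | now elim (HFK s)].
    exists y; split; [apply ED; eauto | exact Hyx].
  - intros (y & Hy & Hyx); apply ED in Hy as [u Hu]; left.
    exists y; split; [exact Hyx | exists (S (u + y))].
    split; [exists u; split; [lia | exact Hu] | split; [lia | auto]]. }
assert (Repaired : forall K, Bad K -> exists s, same_set (B K) (odd_chain K s)).
{ intros K HK; apply EF in HK; destruct (least_exists _ HK) as (s & Hs & Hmin).
  exists s; intros x; split.
  - intros [(y & Hyx & t & _ & Hyt & Ht) | (s' & Hs' & Hmin' & Hx)].
    (* What was enumerated before the switch is below [s], hence below the length of the chain, and
       [chain eta m] contains all numbers below [m]. *)
    + assert (t < s) by (apply Nat.nle_gt; intros Hst; apply (Ht s); auto; lia).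
      apply (chain_saturated _ y); [exact Hyx | ].
      apply chain_lt; pose proof (pair_code_ge K s); lia.
    + replace s with s'; [exact Hx | ].
      destruct (Nat.lt_trichotomy s s') as [H | [H | H]]; auto.
      * now elim (Hmin' s H).
      * now elim (Hmin s' H).
  - intros Hx; right; exists s; auto. }
assert (Htrans : forall X Y Z : nset, same_set X Y -> same_set Y Z -> same_set X Z)
  by (intros X Y Z H1 H2 x; rewrite (H1 x); apply H2).
assert (Hsym : forall X Y : nset, same_set X Y -> same_set Y X)
  by (intros X Y H x; symmetry; apply H).
exists (fun L => exists K, same_set L (B K)); split; [ | split].
- exists B; split; [exact HB | split; [ | split; [ | reflexivity]]].
  + intros K K' HKK' HE.
    destruct (classic (Bad K)) as [HK | HK], (classic (Bad K')) as [HK' | HK'].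
    * destruct (Repaired K HK) as [s Hs], (Repaired K' HK') as [s' Hs'].
      assert (E : same_set (odd_chain K s) (odd_chain K' s')) by eauto.
      assert (Em : S (S (S (pair_code K s + pair_code K s))) =
                   S (S (S (pair_code K' s' + pair_code K' s')))).
      { eapply misses_unique; [apply chain_saturated | | apply chain_misses].
        eapply misses_ext; [exact E | apply chain_misses]. }
      assert (Ep : pair_code K s = pair_code K' s') by lia.
      now apply pair_code_inj in Ep as [].
    * destruct (Repaired K HK) as [s Hs]; apply (Hchain K' (pair_code K s) HK').
      eauto.
    * destruct (Repaired K' HK') as [s Hs]; apply (Hchain K (pair_code K' s) HK).
      eauto.
    * apply HKK', Hinj; auto.
      apply (Htrans _ (B K)); [apply Hsym, Good, HK | ].
      apply (Htrans _ (B K')); [exact HE | apply Good, HK'].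
  + intros K; destruct (classic (Bad K)) as [HK | HK].
    * destruct (Repaired K HK) as [s Hs]; exists (odd_chain K s); intros x.
      rewrite (Hs x); split; [intros H; exists x; auto | ].
      intros (y & Hy & Hyx); now apply (chain_saturated _ y).
    * exists (Core K); auto.
- intros K L HK HL; exists K; eauto.
- intros L [K HL]; destruct (classic (Bad K)) as [HK | HK].
  + right; destruct (Repaired K HK) as [s Hs]; exists (pair_code K s).
    eapply Htrans; [exact HL | exact Hs].
  + left; exists K; eauto.
Qed.

Definition finitely_many_classes (A : nset) : Prop :=
  exists l, (forall y, In y l -> A y) /\ forall x, A x -> exists y, In y l /\ eta y x.

Lemma chain_finite m : finitely_many_classes (chain eta m).
Proof.
exists (reps eta m); split.
- intros y Hy; apply In_reps in Hy as (j & Hj & ->); now apply chain_rep.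
- intros x (j & Hj & Hx); exists (rep eta j); split; [apply In_reps; eauto | exact Hx].
Qed.

Lemma text_prefix_content T L x :
  is_text T L -> L x -> exists n0, forall n, n0 <= n -> content (seq_code (initial T n)) x.
Proof.
intros HT Hx; apply HT in Hx as [k Hk]; exists (S k); intros n Hn.
apply content_spec, In_initial; exists k; split; [lia | exact Hk].
Qed.

Lemma text_content_in T L n x :
  is_text T L -> content (seq_code (initial T n)) x -> L x.
Proof.
intros HT Hx; apply HT; apply content_spec, In_initial in Hx as (k & _ & Hk); eauto.
Qed.

Lemma content_closure_eventually T L :
  is_text T L -> saturated eta L -> finitely_many_classes L ->
  exists n0, forall n, n0 <= n ->
    same_set (eta_closure eta (content (seq_code (initial T n)))) L.
Proof.
intros HT HL (l & Hl & Hcov).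
assert (Hn : exists n0, forall n, n0 <= n -> forall y, In y l ->
  content (seq_code (initial T n)) y).
{ clear Hcov; induction l as [ | a l IH]; [exists 0; easy | ].
  destruct IH as [n0 Hn0]; [intros; apply Hl; now right | ].
  destruct (text_prefix_content T L a HT) as [n1 Hn1]; [apply Hl; now left | ].
  exists (n0 + n1); intros n Hn y [<- | Hy]; [apply Hn1; lia | apply Hn0; auto; lia]. }
destruct Hn as [n0 Hn0]; exists n0; intros n Hn x; split.
- intros (y & Hy & Hyx); apply (HL y); [exact Hyx | ]; eapply text_content_in; eauto.
- intros Hx; destruct (Hcov x Hx) as (y & Hy & Hyx); exists y; auto.
Qed.

(** Acceptability turns an r.e. system of hypotheses, indexed by the data, into a learner; for
    saturated hypotheses the closure changes nothing. *)
Lemma bc_learnable_intro W (H : nat -> nset) (C : nset -> Prop) :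
  acceptable W -> re2 H -> (forall s, saturated eta (H s)) ->
  (forall L T, C L -> is_text T L -> exists n0, forall n, n0 <= n ->
     same_set (H (seq_code (initial T n))) L) ->
  bc_learnable W eta C.
Proof.
intros [_ HW] HH Hsat HC; destruct (HW H HH) as (f & [p Hp] & Hf).
exists (fun l => Some (f (seq_code l))); split.
- exists (Comp Succ p); intros l; eexists; split; [apply Hp | reflexivity].
- intros L HL T HT; destruct (HC L T HL HT) as [n0 Hn0]; exists n0; intros n Hn.
  eexists; split; [reflexivity | ]; intros x; rewrite <- (Hn0 n Hn x); split.
  + intros (y & Hy & Hyx); apply Hf in Hy; now apply (Hsat _ y).
  + intros Hx; exists x; split; [now apply Hf | apply eta_refl].
Qed.

(** * Unions of at most two classes *)

Definition two_classes (x y : nat) : nset := fun z => eta x z \/ eta y z.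

Lemma two_classes_family W :
  acceptable W ->
  exists C, eta_family eta C /\ bc_learnable W eta C /\
    forall x y L, same_set L (two_classes x y) -> C L.
Proof.
intros HW.
assert (Ecl : forall K, same_set (eta_closure eta (fun y => y = pi1 K \/ y = pi2 K))
                                 (two_classes (pi1 K) (pi2 K))).
{ intros K x; unfold eta_closure, two_classes; split.
  - intros (y & [-> | ->] & Hy); auto.
  - intros [H | H]; eauto. }
(* A pair is good if both components are least in their classes and in weakly increasing order, so
   each union has exactly one good code. *)
destruct (repaired_family (fun K y => y = pi1 K \/ y = pi2 K)
  (fun K => (exists z, z < pi1 K /\ eta z (pi1 K)) \/
            (exists z, z < pi2 K /\ eta z (pi2 K)) \/ pi2 K < pi1 K))
  as (C & HC & Hin & Hout); [enum | enum | | | ].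
- assert (Least : forall x y, ~ (exists z, z < x /\ eta z x) ->
    ~ (exists z, z < y /\ eta z y) -> eta x y -> x = y).
  { intros x y Hx Hy; apply least_eq; intros z Hz Hz'; eauto. }
  intros K K' HK HK' HE.
  assert (E : same_set (two_classes (pi1 K) (pi2 K)) (two_classes (pi1 K') (pi2 K'))).
  { intros x; now rewrite <- (Ecl K x), <- (Ecl K' x). }
  apply not_or_and in HK as [H1 HK], HK' as [H1' HK'].
  apply not_or_and in HK as [H2 H3], HK' as [H2' H3'].
  rewrite <- (pair_pi K), <- (pair_pi K').
  pose proof (proj1 (E (pi1 K)) (or_introl (eta_refl _))) as E1.
  pose proof (proj1 (E (pi2 K)) (or_intror (eta_refl _))) as E2.
  pose proof (proj2 (E (pi1 K')) (or_introl (eta_refl _))) as E1'.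
  pose proof (proj2 (E (pi2 K')) (or_intror (eta_refl _))) as E2'.
  assert (F1 : pi1 K = pi1 K' \/ pi1 K = pi2 K')
    by (destruct E1; [left | right]; apply Least; auto).
  assert (F2 : pi2 K = pi1 K' \/ pi2 K = pi2 K')
    by (destruct E2; [left | right]; apply Least; auto).
  assert (F1' : pi1 K' = pi1 K \/ pi1 K' = pi2 K)
    by (destruct E1'; [left | right]; apply Least; auto).
  assert (F2' : pi2 K' = pi1 K \/ pi2 K' = pi2 K)
    by (destruct E2'; [left | right]; apply Least; auto).
  f_equal; lia.
- intros K j _ HE.
  assert (E : same_set (two_classes (pi1 K) (pi2 K)) (chain eta (S (S (S (j + j)))))).
  { intros x; now rewrite <- (HE x), <- (Ecl K x). }
  (* The chains used for repair have at least three classes, too many for two representatives. *)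
  assert (Hr : forall i, i < 3 -> two_classes (pi1 K) (pi2 K) (rep eta i)).
  { intros i Hi; apply E, chain_rep; lia. }
  assert (Hne : forall i k x, i < k -> eta x (rep eta i) -> eta x (rep eta k) -> False).
  { intros i k x Hik Hi Hk; apply (proj1 (rep_spec k) i Hik); eauto. }
  assert (N01 := fun x => Hne 0 1 x (le_n _)).
  assert (N12 := fun x => Hne 1 2 x (le_n _)).
  assert (N02 := fun x => Hne 0 2 x (le_S _ _ (le_n _))).
  destruct (Hr 0) as [H0 | H0], (Hr 1) as [H1 | H1], (Hr 2) as [H2 | H2]; eauto; lia.
- exists C; split; [exact HC | split].
  + apply bc_learnable_intro with (fun s => eta_closure eta (content s)); auto.
    * pose proof dec_content; unfold eta_closure; enum.
    * intros L T HL HT; apply content_closure_eventually; auto.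
      -- destruct (Hout L HL) as [(K & _ & E) | (j & E)]; intros x y Hxy Hx; apply E.
         ++ apply E in Hx; now apply (closure_saturated _ x).
         ++ apply E in Hx; now apply (chain_saturated _ x).
      -- destruct (Hout L HL) as [(K & _ & E) | (j & E)].
         ++ exists [pi1 K; pi2 K]; split.
            ** intros y [<- | [<- | []]]; apply E, Ecl; [left | right]; auto.
            ** intros x Hx; apply E, Ecl in Hx as [Hx | Hx]; eexists; (split; [ | exact Hx]);
                 simpl; auto.
         ++ destruct (chain_finite (S (S (S (j + j))))) as (l & Hl & Hc); exists l; split.
            ** intros y Hy; now apply E, Hl.
            ** intros x Hx; now apply Hc, E.
  + intros x y L HL.
    destruct (least_of_class x) as (x' & Hx & Mx), (least_of_class y) as (y' & Hy & My).
    assert (Hgood : forall u v, (forall z, z < u -> ~ eta z u) ->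
      (forall z, z < v -> ~ eta z v) -> u <= v ->
      same_set L (two_classes u v) -> C L).
    { intros u v Hu Hv Huv HE; apply (Hin (pair_code u v)).
      - simp_pi; intros [(z & Hz & Hz') | [(z & Hz & Hz') | H]]; [ | | lia].
        + now apply (Hu z).
        + now apply (Hv z).
      - intros z; rewrite (HE z), (Ecl _ z); now simp_pi. }
    assert (E' : same_set L (two_classes x' y')).
    { intros z; rewrite (HL z); unfold two_classes; split; intros [H | H]; eauto. }
    destruct (Nat.le_ge_cases x' y') as [Hle | Hle].
    * now apply (Hgood x' y').
    * apply (Hgood y' x'); auto.
      intros z; rewrite (E' z); unfold two_classes; tauto.
Qed.

End Positive.

(** * Infinite r.e. unions of classes that omit a given class *)

Section Columns.

Context (eta : nat -> nat -> Prop) (heta : positive_equivalence eta).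

Let eta_refl x : eta x x.
Proof. apply heta. Qed.

Let eta_sym x y : eta x y -> eta y x.
Proof. apply heta. Qed.

Let eta_trans x y z : eta x y -> eta y z -> eta x z.
Proof. apply heta. Qed.

Let eta_re : re2 eta.
Proof. apply heta. Qed.

Let ch_re : re2 (chain eta) := chain_re eta heta.

(** The only [z] that is never declared dead for [m] carries the least element of class [m] and a
    locking pair for that class. *)
Definition class_locks_codes (G : nat -> nat -> Prop) (Dead : nat -> nat -> Prop)
    (b s N : nat -> nat) : Prop :=
  re2 Dead /\ recursive b /\ recursive s /\ recursive N /\
  (forall m, exists z, ~ Dead m z) /\
  (forall m z z', ~ Dead m z -> ~ Dead m z' -> z = z') /\
  forall m z, ~ Dead m z -> b z = rep eta m /\ locks G (eta (b z)) (s z) (N z).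

Lemma class_locks_codes_exist G :
  re2 G -> (forall x, exists s N, locks G (eta x) s N) ->
  exists Dead b s N, class_locks_codes G Dead b s N.
Proof.
intros HG Hlocks.
pose (A := fun m w => (forall x, x < pi1 w -> chain eta m x) /\
  (forall x, content (pi1 (pi2 w)) x -> eta (pi1 w) x)).
assert (HA : re2 A) by (unfold A; enum).
destruct (re2_witness _ HA) as (D & HD & ED).
(* The condition [A] is r.e. and must be refutable, so [v] carries a witness for it. With [A], the
   number [pi1 (pi1 v)] is [rep eta m] unless it lies in the chain, which is r.e.; failure of
   locking is r.e. too. *)
pose (B := fun m v => ~ D m (pi1 v) (pi2 v) \/ chain eta m (pi1 (pi1 v)) \/
  exists r, exists o, extends (pi1 (pi2 (pi1 v))) r /\
    (forall x, content r x -> eta (pi1 (pi1 v)) x) /\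
    pi2 (pi2 (pi1 v)) < o /\ G r o).
assert (HB : re2 B) by (unfold B; enum).
destruct (corec_unique_choice B HB) as (Dead & HDead & Hex & Huniq & Hok).
{ intros m; destruct (Hlocks (rep eta m)) as (s & N & Hs & Hl).
  assert (HAw : A m (pair_code (rep eta m) (pair_code s N))).
  { split; simp_pi; [apply rep_spec, heta | exact Hs]. }
  apply ED in HAw as [u Hu].
  exists (pair_code (pair_code (rep eta m) (pair_code s N)) u).
  unfold B; simp_pi; intros [H | [H | (r & o & Hr & Hov & Ho & HG')]].
  - easy.
  - now apply (rep_not_chain eta heta m).
  - pose proof (Hl r o Hr Hov HG'); lia. }
exists Dead, (fun z => pi1 (pi1 (pi1 z))), (fun z => pi1 (pi2 (pi1 (pi1 z)))),
  (fun z => pi2 (pi2 (pi1 (pi1 z)))).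
split; [exact HDead | ].
split; [rec | split; [rec | split; [rec | split; [exact Hex | split; [exact Huniq | ]]]]].
intros m z Hz; specialize (Hok m z Hz); cbv beta.
apply not_or_and in Hok as [H1 Hok]; apply not_or_and in Hok as [H2 H3].
apply NNPP in H1.
destruct (proj2 (ED _ _) (ex_intro _ _ H1)) as [H4 H5].
split; [ | split; [exact H5 | ]].
- destruct (Nat.lt_trichotomy (pi1 (pi1 (pi1 z))) (rep eta m)) as [H | [H | H]].
  + elim H2; now apply rep_spec.
  + exact H.
  + now elim (rep_not_chain eta heta m); apply H4.
- intros r o Hr Hov HGr; apply Nat.nlt_ge; intros Hlt; apply H3; eauto 7.
Qed.

(* As [Dead] is r.e., the index [z] with [~ Dead m z] is limit computable from [m],
   which is all that can be had uniformly for sets omitting a given class. *)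
Definition avoiding_sets (Dead : nat -> nat -> Prop) (b : nat -> nat)
    (U : nat -> nat -> nat -> Prop) : Prop :=
  re2 Dead /\ recursive b /\ re3 U /\
  (forall m, exists z, ~ Dead m z) /\
  (forall m z z', ~ Dead m z -> ~ Dead m z' -> z = z') /\
  forall m z, ~ Dead m z ->
    b z = rep eta m /\ saturated eta (U m z) /\
    (forall x, chain eta m x -> U m z x) /\ ~ U m z (rep eta m) /\
    forall n, exists y, n <= y /\
      U m z y /\ ~ chain eta m y /\ forall x, x < y -> ~ eta x y.

(* An extension of a locking sequence for the class of [b] on which the learner
   exceeds the bound shows that an element it contains is not in that class; the
   finitely many hypotheses below the bound account for the exceptions. *)
Lemma avoiding_sets_exist W C (M : learner) :
  (forall x y L, same_set L (two_classes eta x y) -> C L) ->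
  recursive_learner M -> bc_learns W eta M C ->
  (forall L, C L -> forall T, is_text T L ->
     exists l : list (option nat), forall n, 1 <= n -> In (M (initial T n)) l) ->
  exists Dead b U, avoiding_sets Dead b U.
Proof.
intros HC HM Hbc Hvac.
assert (HG := graph_re M HM).
destruct (class_locks_codes_exist (graph M) HG)
  as (Dead & b & s & N & HDead & Hb & Hs & HN & Hex & Huniq & Hlock).
{ intros x; apply locks_exists; intros T HT; apply vac_bounded.
  apply (Hvac (eta x)); [ | exact HT].
  apply (HC x x); intros y; unfold two_classes; tauto. }
pose (U := fun m z y => chain eta m y \/
  exists r, exists o, extends (s z) r /\
    (forall x, content r x -> eta (b z) x \/ eta y x) /\ N z < o /\ graph M r o).
exists Dead, b, U.
assert (HU : re3 U) by (unfold U; enum).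
split; [exact HDead | split; [exact Hb | split; [exact HU | ]]].
split; [exact Hex | split; [exact Huniq | ]].
intros m z Hz; destruct (Hlock m z Hz) as [Eb [Hs1 Hs2]].
split; [exact Eb | ]; split; [ | split; [ | split]].
- intros x y Hxy [Hx | (r & o & Hr & Hov & Ho)].
  + left; now apply (chain_saturated eta heta m x).
  + right; exists r, o; split; [exact Hr | split; [ | exact Ho]].
    intros x' Hx'; destruct (Hov x' Hx'); eauto.
- now left.
- intros [H | (r & o & Hr & Hov & Ho & HGr)].
  + now apply (rep_not_chain eta heta m).
  + assert (o <= N z); [ | lia].
    apply (Hs2 r o Hr); [ | exact HGr].
    intros x Hx; destruct (Hov x Hx) as [H | H]; [exact H | now rewrite Eb].
(* Otherwise every least element [y >= n] outside the chain is outside [U m z], which makes the pair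
   locking on the classes of [b z] and [y]. These are infinitely many different sets, but at most
   [N z] bounds their hypotheses. *)
- intros n; apply NNPP; intros Hno.
  apply (unbounded_pigeonhole
    (fun y => n <= y /\ b z < y /\ ~ chain eta m y /\ forall x, x < y -> ~ eta x y)
    (fun e y => same_set (eta_closure eta (W e)) (two_classes eta (b z) y)) (N z)).
  (* As [rep eta i >= i], this index clears all the lower bounds and the chain at once. *)
  + intros k; exists (rep eta (S (n + m + b z + k))).
    pose proof (rep_ge eta heta (S (n + m + b z + k))).
    split; [lia | split; [lia | split; [lia | split]]].
    * intros (j & Hj & Hjx).
      apply (proj1 (rep_spec eta heta (S (n + m + b z + k))) j); [lia | exact Hjx].
    * intros x Hx Hxr; apply (rep_least eta heta) in Hxr; lia.
  + intros y (Hn & Hby & Hch & Hmin).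
    apply (locks_hypothesis W eta M C (two_classes eta (b z) y) (two_classes eta (b z) y)
      (s z) (N z)); auto.
    * now apply (HC (b z) y).
    * split; [now left; apply Hs1 | ].
      intros r o Hr Hov HGr; apply Nat.nlt_ge; intros Hlt; apply Hno.
      exists y; split; [exact Hn | split; [ | auto]].
      right; exists r, o; auto.
    * now left; apply Hs1.
  + intros e y y' (_ & Hby & _ & Hmin) (_ & Hby' & _ & Hmin') Hy Hy'.
    assert (H : two_classes eta (b z) y y') by (apply Hy, Hy'; right; auto).
    destruct H as [H | H]; [now elim (Hmin' (b z)) | ].
    now apply (least_eq eta heta).
Qed.

End Columns.

(** * Diagonalization in the even columns *)

Section Diagonal.

Context (eta : nat -> nat -> Prop) (heta : positive_equivalence eta)
  (W : nat -> nset) (hW : acceptable W)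
  (Dead : nat -> nat -> Prop) (b : nat -> nat) (U : nat -> nat -> nat -> Prop)
  (hU : avoiding_sets eta Dead b U)
  (D : nat -> nat -> nat -> Prop) (D_dec : dec3 D)
  (D_spec : forall p s,
     (forall x, content s x -> U (pi1 p) (pi2 p) x) <-> exists t, D p s t)
  (E : nat -> nat -> nat -> Prop) (E_dec : dec3 E)
  (E_spec : forall p y, U (pi1 p) (pi2 p) y <-> exists t, E p y t)
  (F : nat -> nat -> nat -> Prop) (F_dec : dec3 F)
  (F_spec : forall m z, Dead m z <-> exists t, F m z t).

Let eta_refl x : eta x x.
Proof. apply heta. Qed.

Let eta_sym x y : eta x y -> eta y x.
Proof. apply heta. Qed.

Let eta_trans x y z : eta x y -> eta y z -> eta x z.
Proof. apply heta. Qed.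

Let eta_re : re2 eta.
Proof. apply heta. Qed.

Let ch_re : re2 (chain eta) := chain_re eta heta.

Let U_re : re3 U.
Proof. apply hU. Qed.

Let W_re : re2 W.
Proof. apply hW. Qed.

Let b_rec : recursive b.
Proof. apply hU. Qed.

Let Dead_re : re2 Dead.
Proof. apply hU. Qed.

(* [q] codes [<<s,N>,t>]; in column [m = 2 mu] it is refuted unless [t] witnesses
   that [s] is over [U m z] and [s], [N] are locking for the learner with graph
   [W (pi1 mu)]. *)
Definition refuted (mu z q : nat) : Prop :=
  ~ D (pair_code (mu + mu) z) (pi1 (pi1 q)) (pi2 q) \/
  exists r, exists o, extends (pi1 (pi1 q)) r /\
    (forall x, content r x -> U (mu + mu) z x) /\
    pi2 (pi1 q) < o /\ W (pi1 mu) (pair_code r o).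

(** If all candidates are refuted, this is all of [U (mu + mu) z] for the right [z]; otherwise only
    elements below the least surviving candidate contribute, besides the chain. *)
Definition limit_set (mu z x : nat) : Prop :=
  chain eta (mu + mu) x \/
  exists y, eta y x /\ U (mu + mu) z y /\ forall q, q < S y -> refuted mu z q.

Definition finite_set (mu z y x : nat) : Prop :=
  chain eta (mu + mu) x \/ exists y', eta y' x /\ U (mu + mu) z y' /\ y' < S y.

(* [K] codes [<<mu,z>,0>] for the limit set, and [<<mu,z>,S <y,t>>] for the finite
   set up to [y], where [t] has to be the least witness of [U m z y]. *)
Definition core (K x : nat) : Prop :=
  pi2 K = 0 /\ limit_set (pi1 (pi1 K)) (pi2 (pi1 K)) x \/
  pi2 K <> 0 /\
    finite_set (pi1 (pi1 K)) (pi2 (pi1 K)) (pi1 (Nat.pred (pi2 K))) x.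

(** The first three clauses leave one code for each finite set. The last one demands a candidate up
    to [y] that survives, which separates the finite set from the limit set. *)
Definition bad_finite (mu z k : nat) : Prop :=
  ~ (E (pair_code (mu + mu) z) (pi1 k) (pi2 k) /\
     forall t, t < pi2 k -> ~ E (pair_code (mu + mu) z) (pi1 k) t) \/
  (exists y', y' < pi1 k /\ eta y' (pi1 k)) \/
  chain eta (mu + mu) (pi1 k) \/
  forall q, q < S (pi1 k) -> refuted mu z q.

Definition bad (K : nat) : Prop :=
  Dead (pi1 (pi1 K) + pi1 (pi1 K)) (pi2 (pi1 K)) \/
  pi2 K <> 0 /\ bad_finite (pi1 (pi1 K)) (pi2 (pi1 K)) (Nat.pred (pi2 K)).

Lemma refuted_re : re3 refuted.
Proof. unfold refuted; enum. Qed.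

Lemma limit_set_re : re3 limit_set.
Proof. pose proof refuted_re; unfold limit_set; enum. Qed.

Lemma core_re : re2 core.
Proof. pose proof limit_set_re; unfold core, finite_set; enum. Qed.

Lemma bad_re : re bad.
Proof. pose proof refuted_re; unfold bad, bad_finite; enum. Qed.

(** The code [s] of the data doubles as the stage of the search for a proof that [p] is dead. The
    number [b (pi2 p)] has to look like the least number missing from the data. *)
Definition plausible (s p : nat) : Prop :=
  (forall t, t < s -> ~ F (pi1 p) (pi2 p) t) /\
  (forall x, x < b (pi2 p) -> content s x) /\ ~ content s (b (pi2 p)).

Definition guess (s p : nat) : Prop :=
  plausible s p /\ forall p', p' < p -> ~ plausible s p'.

Lemma guess_dec : dec2 guess.
Proof. unfold guess, plausible; decide_pred. Qed.

Definition hypothesis (s x : nat) : Prop :=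
  (exists c, content s c /\ eta c x) \/
  exists p, guess s p /\ exists mu, pi1 p = mu + mu /\
    (forall c, content s c -> limit_set mu (pi2 p) c) /\ limit_set mu (pi2 p) x.

Lemma hypothesis_re : re2 hypothesis.
Proof. pose proof limit_set_re; pose proof guess_dec; unfold hypothesis; enum. Qed.

Lemma limit_set_saturated mu z : saturated eta (limit_set mu z).
Proof.
intros x y Hxy [H | (y' & H & H')].
- left; now apply (chain_saturated eta heta _ x).
- right; exists y'; eauto.
Qed.

Lemma finite_set_saturated mu z k : saturated eta (finite_set mu z k).
Proof.
intros x y Hxy [H | (y' & H & H')].
- left; now apply (chain_saturated eta heta _ x).
- right; exists y'; eauto.
Qed.

Lemma core_saturated K : saturated eta (core K).
Proof.
intros x y Hxy [[H H'] | [H H']]; [left | right]; (split; [exact H | ]).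
- now apply (limit_set_saturated _ _ x).
- now apply (finite_set_saturated _ _ _ x).
Qed.

Lemma hypothesis_saturated s : saturated eta (hypothesis s).
Proof.
intros x y Hxy [(c & Hc & Hcx) | (p & Hp & mu & H1 & H2 & H3)]; [left; eauto | right].
exists p; split; [exact Hp | exists mu; split; [exact H1 | split; [exact H2 | ]]].
now apply (limit_set_saturated _ _ x).
Qed.

Lemma limit_set_sub mu z x :
  ~ Dead (mu + mu) z -> limit_set mu z x -> U (mu + mu) z x.
Proof.
intros hz; destruct hU as (_ & _ & _ & _ & _ & H).
destruct (H _ _ hz) as (_ & Hsat & Hch & _); clear H.
intros [H | (y & Hy & HU & _)]; [auto | now apply (Hsat y)].
Qed.

Lemma finite_set_sub mu z y x :
  ~ Dead (mu + mu) z -> finite_set mu z y x -> U (mu + mu) z x.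
Proof.
intros hz; destruct hU as (_ & _ & _ & _ & _ & H).
destruct (H _ _ hz) as (_ & Hsat & Hch & _); clear H.
intros [H | (y' & Hy & HU & _)]; [auto | now apply (Hsat y')].
Qed.

Lemma limit_set_misses mu z :
  ~ Dead (mu + mu) z -> misses eta (mu + mu) (limit_set mu z).
Proof.
intros hz; split.
- intros x Hx; left; now apply rep_spec.
- intros H; apply limit_set_sub in H; [ | exact hz].
  destruct hU as (_ & _ & _ & _ & _ & Hs); now apply (Hs _ _ hz).
Qed.

Lemma finite_set_misses mu z y :
  ~ Dead (mu + mu) z -> misses eta (mu + mu) (finite_set mu z y).
Proof.
intros hz; split.
- intros x Hx; left; now apply rep_spec.
- intros H; apply finite_set_sub in H; [ | exact hz].
  destruct hU as (_ & _ & _ & _ & _ & Hs); now apply (Hs _ _ hz).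
Qed.

Lemma not_bad_finite mu z k :
  ~ bad_finite mu z k ->
  U (mu + mu) z (pi1 k) /\ E (pair_code (mu + mu) z) (pi1 k) (pi2 k) /\
  (forall t, t < pi2 k -> ~ E (pair_code (mu + mu) z) (pi1 k) t) /\
  (forall x, x < pi1 k -> ~ eta x (pi1 k)) /\ ~ chain eta (mu + mu) (pi1 k) /\
  exists q, q <= pi1 k /\ ~ refuted mu z q.
Proof.
intros H; apply not_or_and in H as [H1 H]; apply not_or_and in H as [H2 H].
apply not_or_and in H as [H3 H4]; apply NNPP in H1 as [H1 H1'].
split; [ | split; [exact H1 | split; [exact H1' | split; [ | split; [exact H3 | ]]]]].
- pose proof (proj2 (E_spec _ _) (ex_intro _ _ H1)) as H; now simp_pi.
- intros x Hx Hxk; apply H2; eauto.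
- apply NNPP; intros Hn; apply H4; intros q Hq; apply NNPP; intros Hr.
  apply Hn; exists q; split; [lia | exact Hr].
Qed.

Lemma finite_set_self mu z y : U (mu + mu) z y -> finite_set mu z y y.
Proof. intros H; right; exists y; auto. Qed.

(** [pi1 k] is least in its class and outside the chain, so it could enter the limit set only
    through some [y >= pi1 k], and a surviving candidate [q <= pi1 k] blocks all these. *)
Lemma finite_set_not_limit mu z k :
  ~ bad_finite mu z k -> ~ limit_set mu z (pi1 k).
Proof.
intros H; apply not_bad_finite in H as (_ & _ & _ & Hmin & Hch & q & Hq & Hr).
intros [H | (y & Hy & _ & Hall)]; [auto | ].
destruct (Nat.lt_ge_cases y q) as [Hlt | Hge].
- apply (Hmin y); [lia | exact Hy].
- apply Hr, Hall; lia.
Qed.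

Lemma finite_set_inj_le mu z y y' :
  U (mu + mu) z y' -> ~ chain eta (mu + mu) y' -> (forall x, x < y' -> ~ eta x y') ->
  same_set (finite_set mu z y) (finite_set mu z y') -> y' <= y.
Proof.
intros HU Hch Hmin HE; apply Nat.nlt_ge; intros Hlt.
apply finite_set_self, HE in HU as [H | (x & Hx & _ & Hxy)]; [auto | ].
apply (Hmin x); [lia | exact Hx].
Qed.

Lemma finite_set_finite mu z y : finitely_many_classes eta (finite_set mu z y).
Proof.
assert (H : exists l, (forall x, In x l -> finite_set mu z y x) /\
  forall x, U (mu + mu) z x -> x < S y -> In x l).
{ assert (H : forall n, n <= S y -> exists l, (forall x, In x l -> finite_set mu z y x) /\
    forall x, U (mu + mu) z x -> x < n -> In x l).
  { induction n as [ | n IH]; intros Hn; [exists []; split; [easy | lia] | ].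
    destruct IH as (l & Hl & Hcov); [lia | ].
    destruct (classic (U (mu + mu) z n)) as [HU | HU].
    - exists (n :: l); split.
      + intros x [<- | Hx]; [right; exists n; auto | auto].
      + intros x Hx Hxn; destruct (Nat.eq_dec x n) as [-> | ]; [now left | right].
        apply Hcov; auto; lia.
    - exists l; split; [exact Hl | ].
      intros x Hx Hxn; apply Hcov; auto.
      destruct (Nat.eq_dec x n) as [-> | ]; [easy | lia]. }
  now apply H. }
destruct H as (l & Hl & Hcov), (chain_finite eta heta (mu + mu)) as (l' & Hl' & Hcov').
exists (l ++ l'); split.
- intros x Hx; apply in_app_iff in Hx as [Hx | Hx]; [auto | left; auto].
- intros x [Hx | (y' & Hy' & HU & Hlt)].
  + destruct (Hcov' x Hx) as (w & Hw & Hwx); exists w; rewrite in_app_iff; auto.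
  + exists y'; rewrite in_app_iff; auto.
Qed.

Lemma core_misses K :
  ~ bad K -> misses eta (pi1 (pi1 K) + pi1 (pi1 K)) (core K).
Proof.
intros HK; apply not_or_and in HK as [HD _].
destruct (Nat.eq_dec (pi2 K) 0) as [H0 | H0].
- eapply misses_ext; [ | exact (limit_set_misses _ _ HD)]; intros x; unfold core; tauto.
- eapply misses_ext; [ | exact (finite_set_misses _ _ (pi1 (Nat.pred (pi2 K))) HD)]; intros x; unfold core; tauto.
Qed.

(** The first omitted class gives [mu], the uniqueness of the live index gives [z]. Within a column,
    the number [y] is the largest least element outside the chain, and its witness is the least
    one. *)
Lemma core_inj K K' : ~ bad K -> ~ bad K' -> same_set (core K) (core K') -> K = K'.
Proof.
intros HK HK' HE.
assert (Emu : pi1 (pi1 K) = pi1 (pi1 K')).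
{ assert (pi1 (pi1 K) + pi1 (pi1 K) = pi1 (pi1 K') + pi1 (pi1 K')); [ | lia].
  apply (misses_unique eta heta _ _ (core K')); [apply core_saturated | | ].
  - eapply misses_ext; [exact HE | now apply core_misses].
  - now apply core_misses. }
apply not_or_and in HK as [HD HK], HK' as [HD' HK'].
assert (Ez : pi2 (pi1 K) = pi2 (pi1 K')).
{ destruct hU as (_ & _ & _ & _ & Hu & _).
  rewrite <- Emu in HD'; eapply Hu; eauto. }
assert (E1 : pi1 K = pi1 K').
{ rewrite <- (pair_pi (pi1 K)), <- (pair_pi (pi1 K')); congruence. }
rewrite <- (pair_pi K), <- (pair_pi K'); f_equal; [exact E1 | ].
unfold same_set, core in HE; rewrite <- E1 in HE, HK', HD'.
revert HD HK HK' HE.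
generalize (pi1 (pi1 K)) as mu, (pi2 (pi1 K)) as z; intros mu z HD HK HK' HE.
destruct (pi2 K) as [ | k], (pi2 K') as [ | k']; simpl in *.
- reflexivity.
- assert (Hk : ~ bad_finite mu z k') by (intros H; apply HK'; auto).
  elim (finite_set_not_limit mu z k' Hk).
  destruct (HE (pi1 k')) as [_ [[_ H] | [H _]]]; [ | exact H | easy].
  right; split; [easy | ]; apply finite_set_self, (not_bad_finite mu z k' Hk).
- assert (Hk : ~ bad_finite mu z k) by (intros H; apply HK; auto).
  elim (finite_set_not_limit mu z k Hk).
  destruct (HE (pi1 k)) as [[[_ H] | [H _]] _]; [ | exact H | easy].
  right; split; [easy | ]; apply finite_set_self, (not_bad_finite mu z k Hk).
- assert (Hk : ~ bad_finite mu z k) by (intros H; apply HK; auto).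
  assert (Hk' : ~ bad_finite mu z k') by (intros H; apply HK'; auto).
  apply not_bad_finite in Hk as (HU & HEk & Hmin & Hl & Hch & _).
  apply not_bad_finite in Hk' as (HU' & HEk' & Hmin' & Hl' & Hch' & _).
  assert (HE' : same_set (finite_set mu z (pi1 k)) (finite_set mu z (pi1 k'))).
  { intros x; specialize (HE x); intuition congruence. }
  assert (Ey : pi1 k = pi1 k').
  { apply Nat.le_antisymm.
    - apply (finite_set_inj_le mu z); auto; intros x; symmetry; apply HE'.
    - now apply (finite_set_inj_le mu z). }
  f_equal; rewrite <- (pair_pi k), <- (pair_pi k'); f_equal; [exact Ey | ].
  rewrite <- Ey in HEk', Hmin'.
  destruct (Nat.lt_trichotomy (pi2 k) (pi2 k')) as [H | [H | H]]; [ | exact H | ].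
  + now elim (Hmin' _ H).
  + now elim (Hmin _ H).
Qed.

Lemma core_not_chain K j :
  ~ bad K -> ~ same_set (core K) (chain eta (S (S (S (j + j))))).
Proof.
intros HK HE.
assert (pi1 (pi1 K) + pi1 (pi1 K) = S (S (S (j + j)))); [ | lia].
apply (misses_unique eta heta _ _ (core K)); [apply core_saturated | | ].
- now apply core_misses.
- eapply misses_ext; [ | apply chain_misses, heta]; intros x; symmetry; apply HE.
Qed.

(** The right pair eventually stays plausible. A wrong one dies, or claims too small a missing
    number, which appears in the data, or too large a one, below which [rep eta m] never appears.
    Only finitely many pairs precede the right one. *)
Lemma guess_converges A m z T :
  saturated eta A -> misses eta m A -> ~ Dead m z -> is_text T A ->
  exists n0, forall n, n0 <= n ->
    forall p, guess (seq_code (initial T n)) p <-> p = pair_code m z.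
Proof.
intros HA [HA1 HA2] Hz HT.
destruct hU as (_ & _ & _ & _ & Huniq & Hspec).
assert (Hlen : forall n, n <= seq_code (initial T n)).
{ intros n; rewrite <- (length_initial T n) at 1; apply length_le_seq_code. }
assert (Hsub : forall n x, content (seq_code (initial T n)) x -> A x).
{ intros n x; eapply text_content_in; eauto. }
assert (Htrue : exists n0, forall n, n0 <= n ->
  plausible (seq_code (initial T n)) (pair_code m z)).
{ unfold plausible; simp_pi; rewrite (proj1 (Hspec m z Hz)).
  assert (H : forall k, k <= rep eta m -> exists n0, forall n, n0 <= n ->
    forall x, x < k -> content (seq_code (initial T n)) x).
  { induction k as [ | k IH]; intros Hk; [exists 0; lia | ].
    destruct IH as [n0 Hn0]; [lia | ].
    destruct (text_prefix_content T A k HT) as [n1 Hn1]; [apply HA1; lia | ].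
    exists (n0 + n1); intros n Hn x Hx.
    destruct (Nat.eq_dec x k) as [-> | ]; [apply Hn1; lia | apply Hn0; lia]. }
  destruct (H _ (le_n _)) as [n0 Hn0]; exists n0; intros n Hn.
  split; [intros t _ Ht; apply Hz, F_spec; eauto | split; [auto | ]].
  intros Hc; apply HA2; eauto. }
assert (Hfalse : forall p, p <> pair_code m z -> exists n0, forall n, n0 <= n ->
  ~ plausible (seq_code (initial T n)) p).
{ intros p Hp; destruct (classic (Dead (pi1 p) (pi2 p))) as [HD | HD].
  - apply F_spec in HD as [t Ht]; exists (S t); intros n Hn [H _].
    apply (H t); [specialize (Hlen n); lia | exact Ht].
  - pose proof (proj1 (Hspec _ _ HD)) as Eb.
    destruct (Nat.lt_trichotomy (pi1 p) m) as [H | [H | H]].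
    + destruct (text_prefix_content T A (rep eta (pi1 p)) HT) as [n0 Hn0].
      { apply HA1; now apply rep_lt. }
      exists n0; intros n Hn (_ & _ & Hc); apply Hc; rewrite Eb; auto.
    + elim Hp; rewrite <- (pair_pi p); subst m; f_equal; eapply Huniq; eauto.
    + exists 0; intros n _ (_ & Hc & _); apply HA2, (Hsub n), Hc.
      rewrite Eb; now apply rep_lt. }
assert (Hbelow : forall k, k <= pair_code m z -> exists n0, forall n, n0 <= n ->
  forall p, p < k -> ~ plausible (seq_code (initial T n)) p).
{ induction k as [ | k IH]; intros Hk; [exists 0; lia | ].
  destruct IH as [n0 Hn0]; [lia | ].
  destruct (Hfalse k) as [n1 Hn1]; [lia | ].
  exists (n0 + n1); intros n Hn p Hp.
  destruct (Nat.eq_dec p k) as [-> | ]; [apply Hn1; lia | apply Hn0; lia]. }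
destruct Htrue as [n0 Hn0], (Hbelow _ (le_n _)) as [n1 Hn1].
exists (n0 + n1); intros n Hn p; split.
- intros [Hp Hmin]; destruct (Nat.lt_trichotomy p (pair_code m z)) as [H | [H | H]].
  + elim (Hn1 n) with p; auto; lia.
  + exact H.
  + elim (Hmin _ H); apply Hn0; lia.
- intros ->; split; [apply Hn0; lia | apply Hn1; lia].
Qed.

(** An element of [A] outside the limit set blocks the second clause of [hypothesis] once it is in
    the data; for odd [m] the correct guess belongs to no column. What remains is the closure of the
    data. *)
Lemma hypothesis_of_finite A m T :
  saturated eta A -> misses eta m A -> finitely_many_classes eta A -> is_text T A ->
  (forall mu z, ~ Dead m z -> m = mu + mu -> exists x, A x /\ ~ limit_set mu z x) ->
  exists n0, forall n, n0 <= n -> same_set (hypothesis (seq_code (initial T n))) A.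
Proof.
intros HA Hm Hfin HT Hout.
assert (Hz : exists z, ~ Dead m z) by (apply hU).
destruct Hz as [z Hz].
destruct (guess_converges A m z T HA Hm Hz HT) as [n0 Hn0].
destruct (content_closure_eventually eta T A HT HA Hfin) as [n1 Hn1].
assert (H2 : exists n2, forall n, n2 <= n -> forall mu, m = mu + mu ->
  ~ forall c, content (seq_code (initial T n)) c -> limit_set mu z c).
{ destruct (classic (exists mu, m = mu + mu)) as [[mu Emu] | Hno].
  - destruct (Hout mu z Hz Emu) as (x & Hx & Hlx).
    destruct (text_prefix_content T A x HT Hx) as [n2 Hn2].
    exists n2; intros n Hn mu' Emu' Hc; replace mu' with mu in Hc by lia.
    apply Hlx, Hc; auto.
  - exists 0; intros n _ mu Emu; elim Hno; eauto. }
destruct H2 as [n2 Hn2]; exists (n0 + n1 + n2); intros n Hn x.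
assert (Hle : n1 <= n) by lia; rewrite <- (Hn1 n Hle x); split; [ | now left].
intros [H | (p & Hp & mu & Emu & Hc & _)]; [exact H | ].
apply Hn0 in Hp; [subst p | lia]; simp_pi.
elim (Hn2 n) with mu; auto; lia.
Qed.

Lemma hypothesis_of_limit_set mu z T :
  ~ Dead (mu + mu) z -> is_text T (limit_set mu z) ->
  exists n0, forall n, n0 <= n ->
    same_set (hypothesis (seq_code (initial T n))) (limit_set mu z).
Proof.
intros Hz HT.
destruct (guess_converges _ _ z T (limit_set_saturated mu z) (limit_set_misses mu z Hz) Hz HT)
  as [n0 Hn0].
exists n0; intros n Hn x; split.
- intros [(c & Hc & Hcx) | (p & Hp & mu' & Emu & _ & Hx)].
  + apply (limit_set_saturated _ _ c); [exact Hcx | ]; eapply text_content_in; eauto.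
  + apply Hn0 in Hp; [subst p | exact Hn]; simp_pi.
    now replace mu with mu' by lia.
- intros Hx; right; exists (pair_code (mu + mu) z); split; [now apply Hn0 | ].
  exists mu; simp_pi; split; [reflexivity | split; [ | exact Hx]].
  intros c Hc; eapply text_content_in; eauto.
Qed.

(** If all candidates are refuted, [U] itself is in the family, and its locking pair is a candidate
    that cannot be refuted. Otherwise a surviving candidate locks the learner on [U], and infinitely
    many finite sets share boundedly many hypotheses. *)
Lemma no_learner_on_column mu z C (M : learner) :
  ~ Dead (mu + mu) z -> (forall r o, graph M r o <-> W (pi1 mu) (pair_code r o)) ->
  (forall L, same_set L (limit_set mu z) -> C L) ->
  (forall k L, ~ bad_finite mu z k -> same_set L (finite_set mu z (pi1 k)) -> C L) ->
  bc_learns W eta M C ->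
  (forall L, C L -> forall T, is_text T L ->
     exists l : list (option nat), forall n, 1 <= n -> In (M (initial T n)) l) ->
  False.
Proof.
intros Hz HM Hlim Hfin Hbc Hvac.
destruct hU as (_ & _ & _ & _ & _ & Hspec).
destruct (Hspec _ _ Hz) as (_ & Hsat & Hch & _ & Hinf).
destruct (classic (forall q, refuted mu z q)) as [Hall | Hno].
- assert (HCU : C (U (mu + mu) z)).
  { apply Hlim; intros x; split; [ | now apply limit_set_sub].
    intros Hx; right; exists x; auto. }
  destruct (locks_exists M (U (mu + mu) z)) as (s & N & Hs & Hl).
  { intros T HT; apply vac_bounded; eauto. }
  assert (HD : exists t, D (pair_code (mu + mu) z) s t).
  { apply D_spec; simp_pi; exact Hs. }
  destruct HD as [t Ht].
  destruct (Hall (pair_code (pair_code s N) t)) as [H | (r & o & Hr & Hov & Hlt & Ho)];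
    simp_pi; [easy | ].
  apply HM in Ho; specialize (Hl r o Hr Hov Ho); lia.
- apply not_all_ex_not in Hno as [q Hq].
  pose proof Hq as Hq'; apply not_or_and in Hq' as [HD Hlock]; apply NNPP in HD.
  pose proof (proj2 (D_spec _ _) (ex_intro _ _ HD)) as Hs; simp_pi.
  set (s := pi1 (pi1 q)) in *; set (N := pi2 (pi1 q)) in *.
  (* The content of [s] is below [s], so every finite set with [y >= q] contains it. *)
  assert (Hsq : s <= q).
  { pose proof (pair_code_ge (pi1 q) (pi2 q)) as H1; rewrite pair_pi in H1.
    pose proof (pair_code_ge (pi1 (pi1 q)) (pi2 (pi1 q))) as H2; rewrite pair_pi in H2.
    unfold s; lia. }
  assert (Hlocks : locks (graph M) (U (mu + mu) z) s N).
  { split; [exact Hs | ]; intros r o Hr Hov Ho; apply Nat.nlt_ge; intros Hlt.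
    apply Hlock; exists r, o; rewrite <- HM; auto. }
  apply (unbounded_pigeonhole
    (fun y => q <= y /\ U (mu + mu) z y /\ ~ chain eta (mu + mu) y /\
       forall x, x < y -> ~ eta x y)
    (fun e y => same_set (eta_closure eta (W e)) (finite_set mu z y)) N).
  + intros n; destruct (Hinf (n + q)) as (y & Hy & HP); exists y.
    split; [lia | split; [lia | exact HP]].
  + intros y (Hqy & HU & Hchy & Hmin).
    apply (locks_hypothesis W eta M C _ _ s N Hbc) with (2 := Hlocks).
    * assert (HE : exists t, E (pair_code (mu + mu) z) y t).
      { apply E_spec; simp_pi; exact HU. }
      destruct (least_exists _ HE) as (t & Ht & Htmin).
      apply (Hfin (pair_code y t)); [ | simp_pi; now intros x].
      unfold bad_finite; simp_pi; intros [H | [(x & Hx & Hxy) | [H | H]]]; auto.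
      -- now apply (Hmin x).
      -- apply Hq, H; lia.
    * intros x Hx; right; exists x; apply content_lt in Hx as Hxs.
      split; [apply eta_refl | split; [now apply Hs | lia]].
    * intros x; now apply finite_set_sub.
  + intros e y y' (_ & HU & Hc & Hmin) (_ & HU' & Hc' & Hmin') Hy Hy'.
    apply Nat.le_antisymm.
    * apply (finite_set_inj_le mu z y' y HU Hc Hmin).
      intros x; rewrite <- (Hy' x); apply Hy.
    * apply (finite_set_inj_le mu z y y' HU' Hc' Hmin').
      intros x; rewrite <- (Hy x); apply Hy'.
Qed.

Lemma diagonal_family :
  exists C, eta_family eta C /\ bc_learnable W eta C /\ ~ vac_learnable W eta C.
Proof.
assert (Hcl : forall K, same_set (eta_closure eta (core K)) (core K)).
{ intros K x; split; [ | now exists x].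
  intros (y & Hy & Hyx); now apply (core_saturated K y). }
destruct (repaired_family eta heta core bad core_re bad_re) as (C & HC & Hin & Hout).
{ intros K K' HK HK' HE; apply core_inj; auto.
  intros x; rewrite <- (Hcl K x), <- (Hcl K' x); apply HE. }
{ intros K j HK HE; apply (core_not_chain K j HK).
  intros x; rewrite <- (Hcl K x); apply HE. }
assert (Hext : forall A B T, same_set A B -> is_text T A -> is_text T B).
{ intros A B T HE HT x; rewrite <- (HE x); apply HT. }
exists C; split; [exact HC | split].
- apply (bc_learnable_intro eta heta W hypothesis); auto.
  + apply hypothesis_re.
  + apply hypothesis_saturated.
  + intros L T HL HT.
    assert (Hgoal : exists A, same_set L A /\ exists n0, forall n, n0 <= n ->
      same_set (hypothesis (seq_code (initial T n))) A).
    { destruct (Hout L HL) as [(K & HK & HE) | (j & HE)].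
      - exists (core K).
        assert (HE' : same_set L (core K)) by (intros x; rewrite (HE x); apply Hcl).
        split; [exact HE' | ]; apply (Hext _ _ _ HE') in HT.
        pose proof (core_misses K HK) as Hmiss.
        pose proof (core_saturated K) as Hsat.
        pose proof HK as HK'; apply not_or_and in HK' as [HD HK'].
        destruct (Nat.eq_dec (pi2 K) 0) as [H0 | H0].
        + assert (HK0 : same_set (core K) (limit_set (pi1 (pi1 K)) (pi2 (pi1 K))))
            by (intros x; unfold core; tauto).
          destruct (hypothesis_of_limit_set _ _ T HD (Hext _ _ _ HK0 HT)) as [n0 Hn0].
          exists n0; intros n Hn x; rewrite (HK0 x); now apply Hn0.
        + set (k := Nat.pred (pi2 K)) in *.
          assert (HKf : same_set (core K)
            (finite_set (pi1 (pi1 K)) (pi2 (pi1 K)) (pi1 k)))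
            by (intros x; unfold core, k; tauto).
          assert (Hk : ~ bad_finite (pi1 (pi1 K)) (pi2 (pi1 K)) k) by tauto.
          apply (hypothesis_of_finite (core K) _ T Hsat Hmiss); auto.
          * destruct (finite_set_finite (pi1 (pi1 K)) (pi2 (pi1 K)) (pi1 k))
              as (l & Hl & Hc).
            exists l; split; [intros y Hy; now apply HKf, Hl | ].
            intros x Hx; now apply Hc, HKf.
          * intros mu z Hz Emu; exists (pi1 k).
            assert (mu = pi1 (pi1 K)) as -> by lia.
            replace z with (pi2 (pi1 K)).
            -- split; [ | now apply finite_set_not_limit].
               apply HKf, finite_set_self, (not_bad_finite _ _ k Hk).
            -- destruct hU as (_ & _ & _ & _ & Huniq & _); eapply Huniq; eauto.
      - exists (chain eta (S (S (S (j + j))))); split; [exact HE | ].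
        apply (hypothesis_of_finite _ (S (S (S (j + j)))) T); eauto.
        + now apply chain_saturated.
        + now apply chain_misses.
        + now apply chain_finite.
        + intros mu z _ Emu; lia. }
    destruct Hgoal as (A & HE & n0 & Hn0); exists n0; intros n Hn x.
    rewrite (HE x); now apply Hn0.
- intros (M & HM & Hbc & Hvac).
  pose proof (graph_re M HM) as HG.
  (* Acceptability applied to a constant numbering yields the index [f 0] of the graph of [M], hence
     a column that diagonalizes against [M]. *)
  destruct (proj2 hW (fun _ x => graph M (pi1 x) (pi2 x))) as (f & _ & Hf); [enum | ].
  pose (mu := pair_code (f 0) 0).
  assert (Hz : exists z, ~ Dead (mu + mu) z) by apply hU.
  destruct Hz as [z Hz].
  apply (no_learner_on_column mu z C M Hz); auto.
  + intros r o; unfold mu; rewrite pi1_pair, <- (Hf 0 (pair_code r o)); now simp_pi.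
  + intros L HL; apply (Hin (pair_code (pair_code mu z) 0)).
    * unfold bad; simp_pi; tauto.
    * intros x; rewrite (HL x), (Hcl _ x); unfold core; simp_pi; tauto.
  + intros k L Hk HL; apply (Hin (pair_code (pair_code mu z) (S k))).
    * unfold bad; simp_pi; simpl; tauto.
    * intros x; rewrite (HL x), (Hcl _ x); unfold core; simp_pi; simpl; intuition lia.
Qed.

End Diagonal.

Theorem theorem4 (W : nat -> nset) (hW : acceptable W)
    (eta : nat -> nat -> Prop) (heta : positive_equivalence eta) :
  exists C : nset -> Prop,
    eta_family eta C /\ bc_learnable W eta C /\ ~ vac_learnable W eta C.
Proof.
destruct (two_classes_family eta heta W hW) as (C & HC & Hbc & Hin).
destruct (classic (vac_learnable W eta C)) as [(M & HM & HMbc & HMvac) | Hno].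
- destruct (avoiding_sets_exist eta heta W C M Hin HM HMbc HMvac) as (Dead & b & U & hU).
  pose proof hU as (HDead & _ & HU & _).
  destruct (re2_witness (fun p s => forall x, content s x -> U (pi1 p) (pi2 p) x))
    as (D & HD & ED); [enum | ].
  destruct (re2_witness (fun p y => U (pi1 p) (pi2 p) y)) as (E & HE & EE); [enum | ].
  destruct (re2_witness Dead HDead) as (F & HF & EF).
  exact (diagonal_family eta heta W hW Dead b U hU D HD ED E HE EE F HF EF).
- exists C; auto.
Qed.
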